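(* Let $d\ge1$, $\lambda>0$, $\delta>0$, and let $f:\mathbb{R}^d\to\mathbb{R}$ satisfy: (A1) $f$ is continuous and has at least one minimizer; (A2) $\int_{\mathbb{R}^d}\exp(-f(y)/\delta)\,dy<+\infty$. Then: (i) If $f\in C^1$ and there exist $m>0$, $b\ge0$ with $\langle\nabla f(y),y\rangle\ge m\|y\|^2-b$ for all $y\in\mathbb{R}^d$, then for any $R>0$, $f^{\lambda,\delta}$ is convex on the ball $B(0,R)$ provided \[\lambda\ge\frac{\delta d+b+\sqrt{(\delta d+b)^2+2\delta mR^2}}{2\delta m}.\] (ii) If $f(y)=\frac{\kappa}{2}\|y\|^2+V(y)$ for some $\kappa>0$, where $V$ is bounded with $\operatorname{osc}(V):=\sup V-\inf V<\infty$, then $f^{\lambda,\delta}$ is convex on $\mathbb{R}^d$ provided \[\lambda\ge\frac{e^{\operatorname{osc}(V)/\delta}-1}{\kappa}.\]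
   Context: The soft Moreau envelope is $f^{\lambda,\delta}(x)=-\delta\log\mathbb{E}_{y\sim\mathcal N(x,\lambda\delta I)}[\exp(-f(y)/\delta)]$, where $\mathcal N(x,\lambda\delta I)$ is the Gaussian with mean $x$ and covariance $\lambda\delta I$. *)

(* Defs.v *)
From HB Require Import structures.
From mathcomp Require Import all_boot all_order all_algebra.
From mathcomp Require Import all_classical all_reals all_analysis.
Set Implicit Arguments. Unset Strict Implicit. Unset Printing Implicit Defensive.
Import Order.TTheory GRing.Theory Num.Theory.
Import numFieldNormedType.Exports.
Local Open Scope classical_set_scope.
Local Open Scope ring_scope.

Section defs.
Variable R : realType.

(* Points of R^d are row vectors 'rV[R]_d.  Euclidean structure, explicitly
   (the library's norm on matrices is the sup norm). *)
Definition dotv d (u v : 'rV[R]_d) : R := \sum_(i < d) u ord0 i * v ord0 i.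
Definition enorm d (u : 'rV[R]_d) : R := Num.sqrt (dotv u u).

Definition partial d (f : 'rV[R]_d -> R) (i : 'I_d) (y : 'rV[R]_d) : R :=
  'D_(delta_mx 0 i) f y.
Definition grad d (f : 'rV[R]_d -> R) (y : 'rV[R]_d) : 'rV[R]_d :=
  \row_i partial f i y.

Definition isC1 d (f : 'rV[R]_d -> R) : Prop :=
  (forall y, differentiable f y) /\ (forall i, continuous (partial f i)).

Definition row_of_seq d (ys : seq R) : 'rV[R]_d := \row_i nth 0 ys i.
Definition coords d (x : 'rV[R]_d) : seq R := [seq x ord0 i | i <- enum 'I_d].

(* iterated integral w.r.t. a list of measures on R (one per coordinate);
   for nonnegative measurable integrands this is the product-measure integral
   (Tonelli). *)
Fixpoint iter_int (mus : seq (set R -> \bar R)) (g : seq R -> \bar R) : \bar R :=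
  match mus with
  | [::] => g [::]
  | mu :: ms => (\int[mu]_t iter_int ms (fun ys => g (t :: ys)))%E
  end.

Definition leb_int d (g : 'rV[R]_d -> \bar R) : \bar R :=
  iter_int (nseq d (@lebesgue_measure R)) (fun ys => g (row_of_seq d ys)).

Definition gauss_exp d (x : 'rV[R]_d) (s2 : R) (h : 'rV[R]_d -> \bar R) : \bar R :=
  iter_int [seq (normal_prob m (Num.sqrt s2) : set R -> \bar R) | m <- coords x]
           (fun ys => h (row_of_seq d ys)).

(* soft Moreau envelope f^{lam,del}(x) = -del log E_{y~N(x,lam del I)}[exp(-f(y)/del)]
   (the expectation is finite and positive under (A1)-(A2)) *)
Definition soft_moreau d (f : 'rV[R]_d -> R) (lam del : R) (x : 'rV[R]_d) : R :=
  - del * ln (fine (gauss_exp x (lam * del) (fun y => (expR (- f y / del))%:E))).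

Definition convex_on d (A : set 'rV[R]_d) (F : 'rV[R]_d -> R) : Prop :=
  forall x y t, A x -> A y -> 0 <= t <= 1 ->
    F (t *: x + (1 - t) *: y) <= t * F x + (1 - t) * F y.

Definition eball0 d (r : R) : set 'rV[R]_d := [set x | enorm x < r].

Definition osc d (V : 'rV[R]_d -> R) : R := sup (range V) - inf (range V).

End defs.

(* Main.v *)
(* Up to an additive constant, along a segment [y + t u] the envelope is
   [t^2 |u|^2 / (2 lam) - del ln L(t)], where [L] is the Laplace transform of
   [<u, .> / (lam del)] under a fixed finite measure.  Hence it is convex as soon
   as, for every point [z] of the segment, the Gibbs measure with density
   proportional to [exp (- f / del + <z, .> / (lam del))] with respect to
   N(0, lam del I) has variance at most [lam del |u|^2] in the direction [u].
   In case (i) the variance is bounded by the second moment, which is controlled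
   by the invariance of the normalisation under dilations: this plays the role of
   the integration by parts [E <grad U, Y> = d] for a density [exp (- U)].  In
   case (ii) the variance is at most the mean square deviation from the mean of
   the Gaussian obtained by dropping [V], and dropping [V] changes ratios of
   integrals by a factor at most [exp (osc V / del)]. *)
Require Import Defs.
From HB Require Import structures.
From mathcomp Require Import all_boot all_order all_algebra.
From mathcomp Require Import all_classical all_reals all_analysis.
From mathcomp Require Import measurable_realfun ring lra.
Import Order.TTheory GRing.Theory Num.Theory.
Import numFieldNormedType.Exports.
Local Open Scope classical_set_scope.
Local Open Scope ring_scope.

(** * Gaussian measures on the line *)

Section gaussian_change_of_variables.
Context {R : realType}.
Notation leb := (@lebesgue_measure R).
Import HBNNSimple.

(** For indicators this is how [normal_prob] is built from its density; simple functions follow by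
    linearity and [h] by monotone convergence along [nnsfun_approx]. *)
Lemma ge0_integral_normal_prob (m s : R) (h : R -> \bar R) :
  measurable_fun [set: R] h -> (forall t, 0 <= h t)%E ->
  (\int[normal_prob m s]_t h t = \int[leb]_t (h t * (normal_pdf m s t)%:E))%E.
Proof.
move=> mh h0; pose g := nnsfun_approx measurableT mh.
have mpdf : measurable_fun [set: R] (EFin \o normal_pdf m s).
  by apply/measurable_EFinP; exact: measurable_normal_pdf.
have mg n : measurable_fun [set: R] (EFin \o g n) by exact/measurable_EFinP.
have ndg t : nondecreasing_seq (fun n => (g n t)%:E).
  by move=> i j ij; rewrite lee_fin; exact/lefP/nd_nnsfun_approx.
transitivity (limn (fun n => \int[normal_prob m s]_t (g n t)%:E))%E.
  rewrite -monotone_convergence//=.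
  - by apply: eq_integral => t _; apply/esym/cvg_lim => //; exact: cvg_nnsfun_approx.
  - by move=> n t _; rewrite lee_fin.
transitivity (limn (fun n => \int[leb]_t ((g n t)%:E * (normal_pdf m s t)%:E)))%E; last first.
  rewrite -monotone_convergence//=.
  - apply: eq_integral => t _; apply/cvg_lim => //; apply: cvgeZr => //.
    exact: cvg_nnsfun_approx.
  - by move=> n; apply: emeasurable_funM; [exact: mg|exact: mpdf].
  - by move=> n t _; rewrite mule_ge0// lee_fin// normal_pdf_ge0.
  - by move=> t _ i j ij; apply: lee_wpmul2r; [rewrite lee_fin normal_pdf_ge0|exact: ndg].
apply: congr_lim; apply/funext => n /=.
have mA r : measurable (g n @^-1` [set r]) by exact: measurable_sfunP.
have mi r : measurable_fun [set: R] (fun t => (r * \1_(g n @^-1` [set r]) t)%:E).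
  apply/measurable_EFinP; apply: measurable_funM => //; apply: measurable_indic; exact: mA.
under eq_integral do rewrite fimfunE -fsumEFin//.
rewrite ge0_integral_fsum//; last first.
- by move=> r t _; rewrite EFinM nnfun_muleindic_ge0.
under [RHS]eq_integral.
  move=> t _; rewrite muleC fimfunE -fsumEFin// ge0_mule_fsumr; last first.
    by move=> r; rewrite EFinM nnfun_muleindic_ge0.
  over.
rewrite [RHS]ge0_integral_fsum//; last 2 first.
- by move=> r; exact: (emeasurable_funM mpdf (mi r)).
- move=> r t _; rewrite EFinM mule_ge0//; last by rewrite nnfun_muleindic_ge0.
  by rewrite lee_fin normal_pdf_ge0.
apply: eq_fsbigr => r /set_mem [x _ <-].
have mI : measurable_fun [set: R] (fun t => (\1_(g n @^-1` [set g n x]) t : R)%:E).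
  by apply/measurable_EFinP; apply: measurable_indic; exact: mA.
under eq_integral do rewrite EFinM.
rewrite ge0_integralZl//; last first.
- by rewrite lee_fin.
under [RHS]eq_integral do rewrite EFinM muleCA.
rewrite ge0_integralZl//; last 3 first.
- exact: (emeasurable_funM mpdf mI).
- by move=> t _; rewrite mule_ge0// lee_fin// normal_pdf_ge0.
- by rewrite lee_fin.
congr (_ * _)%E; rewrite integral_indic; [|exact: measurableT|exact: mA].
rewrite (_ : _ `&` _ = g n @^-1` [set g n x]); last exact: setIT.
rewrite /= /normal_prob integral_mkcond.
apply: eq_integral => t _; rewrite patchE indicE.
by case: ifPn => _; rewrite ?mule1 ?mule0.
Qed.

(** By uniqueness of Lebesgue measure: [r] times its image under [t |-> r * t] gives half-open
    intervals their length. *)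
Lemma ge0_integral_lebesgue_scale (r : R) (h : R -> \bar R) : 0 < r ->
  measurable_fun [set: R] h -> (forall t, 0 <= h t)%E ->
  (\int[leb]_t h t = r%:E * \int[leb]_t h (r * t)%R)%E.
Proof.
move=> r0 mh h0.
have mr : measurable_fun [set: measurableTypeR R]
    (fun t : measurableTypeR R => r * t : measurableTypeR R).
  by have := @measurable_funM _ R R setT (cst r) id; apply.
have rge0 : 0 <= r by exact: ltW.
pose nu : {measure set (measurableTypeR R) -> \bar R} := mscale (NngNum rge0)
  (measure_function_pushforward__canonical__measure_function_Measure leb mr).
have nuE A : nu A = (r%:E * leb ((fun t : measurableTypeR R => (r * t)%R) @^-1` A))%E by [].
have E A : measurable A -> leb A = nu A.
  apply: lebesgue_measure_unique => _ [[a b] _ <-].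
  rewrite nuE.
  rewrite (_ : _ @^-1` _ = `]a / r, b / r]%classic); last first.
    by apply/seteqP; split => t /=; rewrite !in_itv/= ltr_pdivrMr// ler_pdivlMr// mulrC.
  rewrite !lebesgue_measure_itv/= !lte_fin ltr_pM2r ?invr_gt0//.
  case: ifPn => _; last by rewrite mule0.
  by rewrite -!EFinD -mulrBl -EFinM mulrC divfK// gt_eqF.
transitivity (\int[nu]_t h t)%E; first by apply: eq_measure_integral => A mA _; exact: E.
rewrite ge0_integral_mscale//; congr (_ * _)%E.
by rewrite ge0_integral_pushforward.
Qed.

(* Density, with respect to N(0, s^2), of the image of N(m, s^2) under
   [t |-> t / r]. *)
Definition gauss_weight (s r m t : R) : R :=
  r * expR ((t ^+ 2 - (r * t - m) ^+ 2) / (2 * s ^+ 2)).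

Lemma gauss_weight_ge0 (s r m t : R) : 0 <= r -> 0 <= gauss_weight s r m t.
Proof. by move=> r0; rewrite mulr_ge0// expR_ge0. Qed.

Lemma measurable_gauss_weight (s r m : R) :
  measurable_fun [set: R] (gauss_weight s r m).
Proof.
apply: measurable_funM => //; apply: measurableT_comp => //.
apply: measurable_funM => //; apply: measurable_funB => //.
by apply: measurable_funX; apply: measurable_funB => //; exact: measurable_funM.
Qed.

(** The substitution [t |-> r * t] is made on Lebesgue integrals; what remains is a ratio of two
    normal densities. Only the scale is substituted, the mean stays in the weight. *)
Lemma ge0_integral_normal_prob_affine (s r m : R) (h : R -> \bar R) :
  s != 0 -> 0 < r -> measurable_fun [set: R] h -> (forall t, 0 <= h t)%E ->
  (\int[normal_prob m s]_t h t =
   \int[normal_prob 0 s]_t (h (r * t)%R * (gauss_weight s r m t)%:E))%E.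
Proof.
move=> s0 r0 mh h0.
have mhr : measurable_fun [set: R] (fun t => h (r * t)).
  by apply: measurableT_comp => //; exact: measurable_funM.
have mg : measurable_fun [set: R] (fun t => (gauss_weight s r m t)%:E).
  by apply/measurable_EFinP; exact: measurable_gauss_weight.
have mpdf : measurable_fun [set: R] (EFin \o normal_pdf m s).
  by apply/measurable_EFinP; exact: measurable_normal_pdf.
have g0 t : (0 <= (gauss_weight s r m t)%:E)%E.
  by rewrite lee_fin gauss_weight_ge0// ltW.
rewrite !ge0_integral_normal_prob//; last 2 first.
- exact: emeasurable_funM.
- by move=> t; exact: mule_ge0.
rewrite (@ge0_integral_lebesgue_scale r)//; last 2 first.
- exact: emeasurable_funM.
- by move=> t; rewrite mule_ge0// lee_fin normal_pdf_ge0.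
rewrite -ge0_integralZl//; last 3 first.
- apply: emeasurable_funM => //.
  by apply: (measurableT_comp mpdf); exact: measurable_funM.
- by move=> t _; rewrite mule_ge0// lee_fin normal_pdf_ge0.
- by rewrite lee_fin ltW.
apply: eq_integral => t _; rewrite muleCA -muleA -!EFinM; congr (_ * _%:E)%E.
rewrite !normal_pdfE// /normal_fun /gauss_weight mulrCA [RHS]mulrC -!mulrA.
congr (_ * _); rewrite [RHS]mulrCA; congr (_ * _).
rewrite -expRD subr0; congr expR; field.
by rewrite s0.
Qed.

End gaussian_change_of_variables.

(** * Gaussian product measures *)

Section gaussian_product.
Context {R : realType}.
Notation mR := (measurableTypeR R).

(* [R] carries two definitionally distinct measurable structures with the same
   measurable sets: iter_int uses the default one, the library's measures on the
   line use [measurableTypeR R]. *)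
Lemma integral_measurableTypeR (mu : {measure set mR -> \bar R}) (h : R -> \bar R) :
  measurable_fun [set: R] h -> (forall t, 0 <= h t)%E ->
  @integral _ R R mu setT h = @integral _ mR R mu setT h.
Proof.
move=> mh h0.
have mid : measurable_fun [set: mR] (idfun : mR -> R) by exact: measurable_id.
by have := @ge0_integral_pushforward _ _ mR R R _ mid mu setT h measurableT mh (fun t _ => h0 t).
Qed.

(** [P] is the [n]-fold product of N(0, s^2), built by induction as the image of [N \x P] under
    cons; Tonelli unfolds the iterated integral. [P] is chosen before [r] and [ms], so all means and
    scales share it. *)
Lemma exists_gauss_product (s : R) (n : nat) : s != 0 ->
  exists P : probability (n.-tuple mR) R,
    forall (r : R) (ms : seq R) (H : seq R -> \bar R), 0 < r -> size ms = n ->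
    (forall ys, 0 <= H ys)%E ->
    measurable_fun [set: n.-tuple mR] (fun y => H (tval y)) ->
    (iter_int [seq (normal_prob m s : set R -> \bar R) | m <- ms] H =
     \int[P]_y (H [seq (r * t)%R | t <- tval y] *
       (\prod_(i < n) gauss_weight s r (nth 0 ms i) (tnth y i))%:E))%E.
Proof.
move=> s0; elim: n => [|n [P IH]].
  exists (\d_([tuple] : 0.-tuple mR)) => r [|//] H r0 _ H0 mH.
  have mG : measurable_fun [set: 0.-tuple mR]
      (fun y => H [seq (r * t)%R | t <- tval y] *
       (\prod_(i < 0) gauss_weight s r (nth 0 [::] i) (tnth y i))%:E)%E.
    rewrite (_ : (fun _ => _) = cst (H [::])); first exact: measurable_cst.
    by apply/funext => y; rewrite tuple0 big_ord0 mule1.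
  rewrite integral_dirac//=.
  by rewrite diracT mul1e big_ord0 mule1.
have mcons : measurable_fun [set: mR * n.-tuple mR]
    (fun p => [tuple of p.1 :: p.2] : n.+1.-tuple mR).
  exact: (measurable_cons measurable_fst measurable_snd).
pose N : probability mR R := normal_prob 0 s.
pose cons_mfun : {mfun (mR * n.-tuple mR)%type >-> (n.+1.-tuple mR)} :=
  HB.pack (fun p : mR * n.-tuple mR => [tuple of p.1 :: p.2] : n.+1.-tuple mR)
    (isMeasurableFun.Build _ _ _ _ _ mcons).
exists (distribution (N \x P)%E cons_mfun) => r [//|m ms] H r0 [sms] H0 mH /=.
have r0' := ltW r0.
have mscale k : measurable_fun [set: k.-tuple mR]
    (fun y => [tuple of [seq r * t | t <- y]] : k.-tuple mR).
  apply/measurable_fun_tnthP => i.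
  rewrite (_ : _ \o _ = (fun y => r * tnth y i)); last first.
    by apply/funext => y /=; rewrite tnth_map.
  have := @measurable_funM _ (k.-tuple mR) R setT (cst r) (fun y => tnth y i).
  by apply; [exact: measurable_cst|exact: measurable_tnth].
have mW k (ls : seq R) : measurable_fun [set: k.-tuple mR]
    (fun y => (\prod_(i < k) gauss_weight s r (nth 0 ls i) (tnth y i))%:E).
  apply/measurable_EFinP; apply: measurable_prod => i _.
  apply: (measurableT_comp (measurable_gauss_weight s r (nth 0 ls i))).
  exact: measurable_tnth.
have W0 k (ls : seq R) (y : k.-tuple mR) :
    (0 <= (\prod_(i < k) gauss_weight s r (nth 0 ls i) (tnth y i))%:E)%E.
  by rewrite lee_fin; apply: prodr_ge0 => i _; exact: gauss_weight_ge0.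
pose F (p : mR * n.-tuple mR) : \bar R := (H (p.1 :: [seq r * t | t <- tval p.2])%R *
  (\prod_(i < n) gauss_weight s r (nth 0 ms i) (tnth p.2 i))%:E)%E.
have F0 p : (0 <= F p)%E by rewrite mule_ge0.
have mF : measurable_fun [set: mR * n.-tuple mR] F.
  apply: emeasurable_funM; last first.
    exact: (measurableT_comp (mW n ms) measurable_snd).
  have mc : measurable_fun [set: mR * n.-tuple mR] (fun p : mR * n.-tuple mR =>
      [tuple of p.1 :: [tuple of [seq r * t | t <- p.2]]] : n.+1.-tuple mR).
    apply: (measurable_cons measurable_fst).
    exact: (measurableT_comp (mscale n) measurable_snd).
  exact: (measurableT_comp mH mc).
(* The inner integral as a function of the first coordinate, which [F] leaves unscaled: its own
   change of variables comes after the induction hypothesis. *)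
pose K t := (\int[P]_y F (t, y))%E.
have K0 t : (0 <= K t)%E by apply: integral_ge0 => y _.
have mK : measurable_fun [set: R] K.
  have mK' : measurable_fun [set: mR] (K : mR -> \bar R).
    exact: measurable_fun_fubini_tonelli_F.
  exact: mK'.
transitivity (@integral _ R R (normal_prob m s) setT K).
  congr (integral _ _ _); apply/funext => t; rewrite (IH r)//.
  have mc : measurable_fun [set: n.-tuple mR]
      (fun y : n.-tuple mR => [tuple of t :: y] : n.+1.-tuple mR).
    apply: (@measurable_cons _ _ (n.-tuple mR) mR (cst (t : mR)) n id).
      exact: measurable_cst.
    exact: measurable_id.
  exact: (measurableT_comp mH mc).
rewrite (integral_measurableTypeR _ _ mK K0).
rewrite (ge0_integral_normal_prob_affine _ _ _ _ s0 r0 mK K0).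
have mG : measurable_fun [set: n.+1.-tuple mR]
   (fun y => H [seq (r * t)%R | t <- tval y] *
    (\prod_(i < n.+1) gauss_weight s r (nth 0 (m :: ms) i) (tnth y i))%:E)%E.
  by apply: emeasurable_funM; [exact: (measurableT_comp mH (mscale n.+1))|exact: mW].
pose G0' (y : n.+1.-tuple mR) := (H [seq (r * t)%R | t <- tval y] *
    (\prod_(i < n.+1) gauss_weight s r (nth 0 (m :: ms) i) (tnth y i))%:E)%E.
pose G (p : mR * n.-tuple mR) := G0' [tuple of p.1 :: p.2].
transitivity (\int[(N \x P)%E]_p G p)%E; last first.
  rewrite [RHS](ge0_integral_pushforward mcons (N \x P)%E measurableT mG)//.
  by move=> y _; rewrite mule_ge0.
have G0 p : (0 <= G p)%E by rewrite /G/= mule_ge0.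
have mG' : measurable_fun [set: mR * n.-tuple mR] G.
  exact: (measurableT_comp mG mcons).
rewrite (fubini_tonelli1 G mG' G0).
apply: eq_integral => t _; rewrite /fubini_F /K muleC -ge0_integralZl//=; last 2 first.
- exact: (measurable_fun_pair2 _ mF).
- by rewrite lee_fin gauss_weight_ge0.
apply: eq_integral => y _.
rewrite muleCA; congr (_ * _)%E; rewrite big_ord_recl EFinM.
congr (_%:E * _%:E)%E.
by apply: eq_bigr => i _; rewrite tnthS.
Qed.
End gaussian_product.

(** * Measurability of open sets and continuous functions in coordinates *)

Section continuous_measurable_row.
Context {R : realType}.
Notation mR := (measurableTypeR R).

(** An open set is the countable union of the boxes inside it with rational centre and radius
    [1 / (k + 1)], and each box is a finite intersection of coordinate cylinders. *)
Lemma measurable_open_row (d : nat) (A : set 'rV[R]_d) : open A ->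
  measurable [set y : d.-tuple mR | A (row_of_seq d (tval y))].
Proof.
move=> oA.
pose box (u : 'rV[rat]_d * nat) : set (d.-tuple mR) :=
  \bigcap_(i in [set: 'I_d])
    [set y | ball (ratr (u.1 ord0 i) : R) (u.2.+1%:R^-1 : R) (tnth y i)].
have mbox u : measurable (box u).
  apply: fin_bigcap_measurable => // i _.
  have oB : measurable (ball (ratr (u.1 ord0 i) : R) (u.2.+1%:R^-1 : R)).
    exact: measurable_ball.
  have := @measurable_tnth _ mR d i measurableT _ oB.
  by rewrite setTI.
pose ok (u : 'rV[rat]_d * nat) := box u `<=` [set y | A (row_of_seq d (tval y))].
rewrite (_ : [set y | _] = \bigcup_u (if `[< ok u >] then box u else set0)).
  apply: countable_bigcupT_measurable; first exact: countableP.
  by move=> u; case: ifPn => _; [exact: mbox|exact: measurable0].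
apply/seteqP; split => [y /= Ay|y [u _]]; last first.
  by case: ifPn => [/asboolP oku /oku|].
have /nbhs_ballP[e /= e0 eA] := open_nbhs_nbhs (conj oA Ay).
(* Two points of one box differ by less than twice its radius in every coordinate, so such a box
   around [y] stays in the ball of radius [e]. *)
have [k ke] : exists k : nat, 2 * k.+1%:R^-1 < e.
  have [k _ hk] := near_infty_natSinv_lt (PosNum (divr_gt0 e0 (ltr0n R 2))).
  exists k; have := hk k (leqnn k); rewrite /= ltr_pdivlMr ?ltr0n// mulrC//.
have k0 : 0 < k.+1%:R^-1 :> R by rewrite invr_gt0 ltr0n.
have /choice[q qP] (i : 'I_d) : exists q : rat, `|ratr q - tnth y i : R| < k.+1%:R^-1.
  have /rat_in_itvoo[q] : (tnth y i : R) - k.+1%:R^-1 < (tnth y i : R) + k.+1%:R^-1.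
    by rewrite ltrBlDr -addrA ltrDl addr_gt0.
  by rewrite in_itv/= => qy; exists q; rewrite ltr_distl.
exists (\row_i q i, k) => //.
have By : box (\row_i q i, k) y by move=> i _; rewrite /= /ball/= mxE; exact: qP.
case: ifPn => // /asboolPn nok; exfalso; apply: nok => z Bz /=; apply: eA.
split => // i j; rewrite /row_of_seq !mxE /ball/=.
have /= := By j I; have /= := Bz j I; rewrite /ball/= mxE.
have nthE (w : d.-tuple mR) : (tval w)`_j = tnth w j by rewrite (tnth_nth 0).
rewrite !nthE => zq yq.
have tri (q0 c a b : R) : `|q0 - a| < c -> `|q0 - b| < c -> 2 * c < e -> `|b - a| < e.
  rewrite !ltr_distl => /andP[h1 h2] /andP[h3 h4] ce.
  by apply/andP; split; lra.
exact: tri zq yq ke.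
Qed.

Lemma measurable_continuous_row (d : nat) (h : 'rV[R]_d -> R) : continuous h ->
  measurable_fun [set: d.-tuple mR] (fun y => h (row_of_seq d (tval y))).
Proof.
move=> /continuousP ch; apply: (measurability _ (RGenOpens.measurableE R)).
move=> _ [_ [a [b ->] <-]]; rewrite setTI.
have oh : open (h @^-1` `]a, b[) by apply: ch; exact: interval_open.
by have := measurable_open_row d _ oh; apply.
Qed.

End continuous_measurable_row.

(** * Laplace transforms *)

Lemma normrX_le_expR {R : realType} (n : nat) (x : R) : `|x| ^+ n <= n`!%:R * expR `|x|.
Proof.
case: n => [|n].
  by rewrite expr0 fact0 mul1r (le_trans _ (expR_ge1Dx _))// lerDl.
rewrite mulrC -ler_pdivrMr ?ltr0n ?fact_gt0//.
by apply: le_trans (expR_ge1Dxn n (normr_ge0 x)); rewrite lerDr.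
Qed.

Lemma expR_norm_le {R : realType} (x : R) : expR `|x| <= expR x + expR (- x).
Proof.
by case: ger0P => _; rewrite ?lerDl ?lerDr expR_ge0.
Qed.

Section laplace.
Context {R : realType} {d} {T : measurableType d} (mu : {measure set T -> \bar R}).
Variables (w q : T -> R).
Hypothesis mw : measurable_fun [set: T] w.
Hypothesis mq : measurable_fun [set: T] q.
Hypothesis q_gt0 : forall x, 0 < q x.
Hypothesis int_exp : forall s : R,
  mu.-integrable [set: T] (fun x => (expR (s * w x) * q x)%:E).

(** [lap 0] is the Laplace transform of [w] under the measure of density [q], and [lap k] its [k]-th
    derivative. *)
Definition lap_integrand (k : nat) (s : R) (x : T) : R := w x ^+ k * (expR (s * w x) * q x).
Definition lap (k : nat) (s : R) : R := \int[mu]_x lap_integrand k s x.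

Let q_ge0 x : 0 <= q x. Proof. exact: ltW. Qed.

Lemma measurable_lap_integrand k s : measurable_fun [set: T] (lap_integrand k s).
Proof.
apply: measurable_funM; first exact: measurable_funX.
apply: measurable_funM => //; apply: measurableT_comp => //.
exact: measurable_funM.
Qed.

(** An integrable majorant of [lap_integrand k s] uniform in [|s| <= S]: [|w|^k] costs [k!] and one
    more unit in the exponent, and [e^|x| <= e^x + e^-x]. *)
Definition lap_bound (k : nat) (S : R) (x : T) : R :=
  k`!%:R * (expR ((1 + S) * w x) * q x + expR (- (1 + S) * w x) * q x).

Lemma lap_integrand_le k (s S : R) x : `|s| <= S ->
  `|lap_integrand k s x| <= lap_bound k S x.
Proof.
move=> sS; have S0 : 0 <= S by rewrite (le_trans _ sS).
rewrite /lap_integrand /lap_bound !normrM normrX [`|expR _|]ger0_norm ?expR_ge0//.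
rewrite [`|q x|]ger0_norm// -mulrDl !mulrA ler_wpM2r//.
apply: (@le_trans _ _ (k`!%:R * expR `|w x| * expR (S * `|w x|))).
  rewrite ler_pM ?expR_ge0 ?exprn_ge0 ?normrX_le_expR// ler_expR.
  by rewrite (le_trans (ler_norm _))// normrM ler_wpM2r.
rewrite -mulrA -expRD ler_wpM2l// mulNr.
rewrite (_ : `|w x| + _ = `|(1 + S) * w x|) ?expR_norm_le//.
by rewrite normrM [`|1 + S|]ger0_norm ?addr_ge0// mulrDl mul1r.
Qed.

Lemma integrable_lap_bound k S : mu.-integrable [set: T] (EFin \o lap_bound k S).
Proof.
have := integrableZl measurableT k`!%:R
  (integrableD measurableT (int_exp (1 + S)) (int_exp (- (1 + S)))).
by [].
Qed.

Lemma integrable_lap k s : mu.-integrable [set: T] (EFin \o lap_integrand k s).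
Proof.
apply: le_integrable (integrable_lap_bound k `|s|) => //.
  by apply/measurable_EFinP; exact: measurable_lap_integrand.
move=> x _; rewrite lee_fin (le_trans (lap_integrand_le k s `|s| x (lexx _)))//.
exact: ler_norm.
Qed.

(** Differentiation under the integral, dominated on the interval of radius 1 around [s] by the
    majorant with [S = |s| + 1]. *)
Lemma is_derive_lap k (s : R) : is_derive s 1 (lap k) (lap k.+1 s).
Proof.
have dE x (t : R) : is_derive t 1 (lap_integrand k ^~ x) (lap_integrand k.+1 t x).
  have dl : is_derive t 1 (fun u : R => u * w x) (w x).
    by apply: is_derive_eq; rewrite scaler0 add0r /GRing.scale/= mulr1.
  have de := @is_derive1_comp R expR (fun u => u * w x) t _ _ (is_derive_expR _) dl.
  rewrite /lap_integrand.
  have dm := @is_deriveZ R R R _ (w x ^+ k * q x) t 1 _ de.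
  rewrite (_ : (fun u => _) = (w x ^+ k * q x) \*: (expR \o (fun u => u * w x))).
    by apply: (is_derive_eq dm); rewrite exprS /GRing.scale/=; ring.
  by apply/funext => u; rewrite /= /GRing.scale/=; ring.
have sI : s \in `](s - 1), (s + 1)[ by rewrite in_itv/= ltrBlDr ltrDl ltr01.
have bnd : forall t x, `](s - 1), (s + 1)[%classic t -> [set: T] x ->
    `|partial1of2 (lap_integrand k) t x| <= lap_bound k.+1 (`|s| + 1) x.
  move=> t x tI _; rewrite partial1of2E (@derive_val _ _ _ _ _ _ _ (dE x t)).
  apply: lap_integrand_le; move: tI; rewrite /= in_itv/= => tI.
  rewrite -(subrKC s t) (le_trans (ler_normD _ _))// lerD2l ltW//.
  by rewrite ltr_norml; lra.
have bnd0 x : 0 <= lap_bound k.+1 (`|s| + 1) x.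
  by rewrite mulr_ge0// addr_ge0// mulr_ge0// expR_ge0.
have ds t x : `](s - 1), (s + 1)[%classic t -> [set: T] x ->
    derivable (lap_integrand k ^~ x) t 1.
  by move=> _ _; exact: (@ex_derive _ _ _ _ _ _ _ (dE x t)).
have ii t : `](s - 1), (s + 1)[%classic t ->
    mu.-integrable [set: T] (EFin \o lap_integrand k t).
  by move=> _; exact: integrable_lap.
have ib := integrable_lap_bound k.+1 (`|s| + 1).
apply: DeriveDef.
  exact: (derivable_under_integral measurableT sI ii ds bnd0 ib bnd).
rewrite -derive1E.
rewrite (differentiation_under_integral measurableT sI ii ds bnd0 ib bnd).
apply: eq_Rintegral => x _.
by rewrite partial1of2E (@derive_val _ _ _ _ _ _ _ (dE x s)).
Qed.

Lemma lap0_gt0 s : mu setT != 0%E -> 0 < lap 0 s.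
Proof.
move=> muT; rewrite lt_neqAle; apply/andP; split; last first.
  apply: Rintegral_ge0 => x _; rewrite /lap_integrand expr0 mul1r.
  by rewrite mulr_ge0// expR_ge0.
apply: contra muT => /eqP l0; apply/eqP.
have iE : (\int[mu]_x `|(lap_integrand 0 s x)%:E| = 0)%E.
  have if0 := integrable_lap 0 s.
  under eq_integral.
    move=> x _; rewrite gee0_abs; last first.
      by rewrite lee_fin /lap_integrand expr0 mul1r mulr_ge0// expR_ge0.
    over.
  rewrite -[LHS]fineK ?integrable_fin_num//.
  exact: (congr1 EFin (esym l0)).
have mf : measurable_fun [set: T] (EFin \o lap_integrand 0 s).
  by apply/measurable_EFinP; exact: measurable_lap_integrand.
have [B [mB B0 TB]] := (ae_eq_integral_abs mu measurableT mf).1 iE.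
rewrite -B0; congr (mu _); apply/seteqP; split => // x _; apply: TB => /= xE.
have h0 : lap_integrand 0 s x = 0 by apply: EFin_inj; exact: (xE I).
by move/eqP : h0; rewrite /lap_integrand expr0 mul1r gt_eqF// mulr_gt0// expR_gt0.
Qed.

Lemma lap_sqr_sub (s c : R) :
  \int[mu]_x ((w x - c) ^+ 2 * (expR (s * w x) * q x)) =
  lap 2 s - 2 * c * lap 1 s + c ^+ 2 * lap 0 s.
Proof.
have i2 := integrable_lap 2 s; have i1 := integrable_lap 1 s.
have i0 := integrable_lap 0 s.
have i1' : mu.-integrable [set: T] (EFin \o (fun x => (- (2 * c)) * lap_integrand 1 s x)).
  by have := integrableZl measurableT (- (2 * c)) i1.
have i0' : mu.-integrable [set: T] (EFin \o (fun x => c ^+ 2 * lap_integrand 0 s x)).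
  by have := integrableZl measurableT (c ^+ 2) i0.
have i21 : mu.-integrable [set: T]
    (EFin \o (fun x => lap_integrand 2 s x + (- (2 * c)) * lap_integrand 1 s x)).
  by have := integrableD measurableT i2 i1'.
rewrite -[- (2 * c * _)]mulNr /lap -!RintegralZl// -!RintegralD//.
by apply: eq_Rintegral => x _; rewrite /lap_integrand expr0 expr1; ring.
Qed.

(** The second derivative of [ln (lap 0)] at [s] is the variance of [w] under the normalised tilted
    measure. A mean square deviation from any [c] dominates it, so the hypothesis makes the second
    derivative of [C / 2 * s^2 - ln (lap 0 s)] nonnegative on the open interval. *)
Lemma convex_sub_ln_lap (C t : R) : mu setT != 0%E ->
  (forall s, 0 < s < 1 -> exists c,
    \int[mu]_x ((w x - c) ^+ 2 * (expR (s * w x) * q x)) <= C * lap 0 s) ->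
  0 <= t <= 1 ->
  C / 2 * t ^+ 2 - ln (lap 0 t) <=
    t * (C / 2 - ln (lap 0 1)) - (1 - t) * ln (lap 0 0).
Proof.
move=> muT hC t01.
pose Phi (u : R) : R := C / 2 * u ^+ 2 - ln (lap 0 u).
pose dPhi (u : R) : R := C * u - lap 1 u / lap 0 u.
have L0 u : 0 < lap 0 u by exact: lap0_gt0.
have dP (u : R) : is_derive u 1 Phi (dPhi u).
  have dl := @is_derive1_comp R (@ln R) (lap 0) u _ _ (is_derive1_ln (L0 u)) (is_derive_lap 0 u).
  have dq : is_derive u 1 (fun v : R => C / 2 * v ^+ 2) (C * u).
    by apply: is_derive_eq; rewrite /GRing.scale/=; field.
  apply: (is_derive_eq (is_deriveB dq dl)).
  by rewrite /dPhi; congr (_ - _); rewrite mulrC.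
have ddP (u : R) : is_derive u 1 dPhi (C - (lap 2 u * lap 0 u - lap 1 u ^+ 2) / lap 0 u ^+ 2).
  have n0 : lap 0 u != 0 by rewrite gt_eqF.
  have dv := is_deriveV n0 (is_derive_lap 0 u).
  have dm := is_deriveM (is_derive_lap 1 u) dv.
  have dq : is_derive u 1 (fun v : R => C * v) C.
    by apply: is_derive_eq; rewrite /GRing.scale/=; ring.
  apply: (is_derive_eq (is_deriveB dq dm)).
  by rewrite /GRing.scale/=; field.
have D1 : 'D_1 Phi = dPhi by apply/funext => u; exact: derive_val.
have cPhi : continuous Phi.
  move=> u; apply: differentiable_continuous; apply/derivable1_diffP.
  exact: (@ex_derive _ _ _ _ _ _ _ (dP u)).
have [t0 t1] := andP t01.
have t0' : 0 <= 1 - t by rewrite subr_ge0.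
have t1' : 1 - t <= 1 by rewrite gerBl.
have Phi_hyp u : 0 < u < 1 -> 0 <= 'D_1 ('D_1 Phi) u.
  move=> u01; rewrite D1 (@derive_val _ _ _ _ _ _ _ (ddP u)).
  have [c] := hC u u01; rewrite lap_sqr_sub => hc.
  rewrite subr_ge0 ler_pdivrMr ?exprn_gt0//.
  have l0 := L0 u.
  move: (lap 2 u) (lap 1 u) (lap 0 u) l0 hc => a b e e0 hc.
  (* [a * e - b^2] equals [(a - 2 * c * b + c^2 * e) * e - (b - c * e)^2]. *)
  have := sqr_ge0 (b - c * e).
  have : (a - 2 * c * b + c ^+ 2 * e) * e <= C * e * e by rewrite ler_wpM2r// ltW.
  nra.
(* The weight [1 - t] goes to the endpoint 0, so the combination of 0 and 1 is [t]. *)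
have := @second_derivative_convex R Phi 0 1 Phi_hyp _ _ _ _ (Itv01 t0' t1') ler01.
rewrite !convRE/= /unstable.onem mulr0 add0r mulr1 subKr.
have -> : Phi t = C / 2 * t ^+ 2 - ln (lap 0 t) by [].
have P0 : Phi 0 = - ln (lap 0 0) by rewrite /Phi expr0n/= mulr0 add0r.
have P1 : Phi 1 = C / 2 - ln (lap 0 1) by rewrite /Phi expr1n mulr1.
rewrite P0 P1 => h; rewrite [leRHS]addrC -mulrN; apply: h.
- by rewrite -P1; apply: cvg_at_left_filter; exact: cPhi.
- by rewrite -P0; apply: cvg_at_right_filter; exact: cPhi.
- by move=> u _; exact: (@ex_derive _ _ _ _ _ _ _ (dP u)).
- by move=> u _; rewrite D1; exact: (@ex_derive _ _ _ _ _ _ _ (ddP u)).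
Qed.
End laplace.

(** * Euclidean structure and rays *)

Section euclidean.
Context {R : realType}.

Lemma dotvC {d} (u v : 'rV[R]_d) : dotv u v = dotv v u.
Proof. by apply: eq_bigr => i _; rewrite mulrC. Qed.

Lemma dotvDl {d} (u v w : 'rV[R]_d) : dotv (u + v) w = dotv u w + dotv v w.
Proof. by rewrite /dotv -big_split/=; apply: eq_bigr => i _; rewrite mxE mulrDl. Qed.

Lemma dotvZl {d} (a : R) (u w : 'rV[R]_d) : dotv (a *: u) w = a * dotv u w.
Proof. by rewrite /dotv mulr_sumr; apply: eq_bigr => i _; rewrite mxE mulrA. Qed.

Lemma dotvDr {d} (u v w : 'rV[R]_d) : dotv w (u + v) = dotv w u + dotv w v.
Proof. by rewrite dotvC dotvDl dotvC (dotvC v). Qed.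

Lemma dotvZr {d} (a : R) (u w : 'rV[R]_d) : dotv w (a *: u) = a * dotv w u.
Proof. by rewrite dotvC dotvZl dotvC. Qed.

Lemma dotv_ge0 {d} (u : 'rV[R]_d) : 0 <= dotv u u.
Proof. by apply: sumr_ge0 => i _; rewrite -expr2 sqr_ge0. Qed.

Lemma enorm_sqr {d} (u : 'rV[R]_d) : enorm u ^+ 2 = dotv u u.
Proof. by rewrite sqr_sqrtr// dotv_ge0. Qed.

Lemma dotv_line {d} (y u : 'rV[R]_d) (s : R) : dotv (y + s *: u) (y + s *: u) =
  dotv y y + 2 * s * dotv y u + s ^+ 2 * dotv u u.
Proof. by rewrite !(dotvDl, dotvDr, dotvZl, dotvZr) (dotvC u y); ring. Qed.

Lemma dotv_le {d} (u v : 'rV[R]_d) : 2 * dotv u v <= dotv u u + dotv v v.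
Proof.
have := dotv_ge0 (u + -1 *: v).
rewrite !(dotvDl, dotvDr, dotvZl, dotvZr) (dotvC v u); lra.
Qed.

Lemma dotv_cauchy_schwarz {d} (u v : 'rV[R]_d) :
  dotv u v ^+ 2 <= dotv u u * dotv v v.
Proof.
have [v0|v0] := eqVneq (dotv v v) 0.
  have h (t : R) : 2 * t * dotv u v <= dotv u u.
    have := dotv_le u (t *: v); rewrite !(dotvZl, dotvZr) v0; lra.
  suff -> : dotv u v = 0 by rewrite v0 mulr0 expr0n.
  apply/eqP/negPn/negP => uv0.
  (* This value of [t] makes the left side of [h] equal to [dotv u u + 1]. *)
  have := h ((dotv u u + 1) / (2 * dotv u v)).
  rewrite (_ : 2 * _ * _ = dotv u u + 1); first lra.
  by field.
have vv : 0 < dotv v v by rewrite lt_neqAle eq_sym v0 dotv_ge0.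
(* The scalar is the coefficient of the orthogonal projection of [u] on [v]. *)
have := dotv_le u (dotv u v / dotv v v *: v).
rewrite !(dotvZl, dotvZr) => h.
rewrite -ler_pdivrMr//; apply: le_trans (_ : dotv u u <= _) => //.
have : 2 * (dotv u v / dotv v v * dotv u v) - dotv u v / dotv v v * (dotv u v / dotv v v * dotv v v) = dotv u v ^+ 2 / dotv v v.
  by field.
lra.
Qed.

Lemma continuous_coord {d} (i : 'I_d) : continuous (fun z : 'rV[R]_d => z ord0 i).
Proof. exact: coord_continuous. Qed.

Lemma continuous_dotv {d} (u : 'rV[R]_d) : continuous (dotv u).
Proof.
have c (i : 'I_d) : true -> continuous (fun z : 'rV[R]_d => u ord0 i * z ord0 i).
  by move=> _ z; exact: (cvgM (cvg_cst _) (continuous_coord i z)).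
exact: (@continuous_big R^o _ +%R 0 _ (@add_continuous R^o) _ _ _ c).
Qed.

Lemma continuous_dotvv d : continuous (fun z : 'rV[R]_d => dotv z z).
Proof.
have c (i : 'I_d) : true -> continuous (fun z : 'rV[R]_d => z ord0 i * z ord0 i).
  by move=> _ z; exact: (cvgM (continuous_coord i z) (continuous_coord i z)).
exact: (@continuous_big R^o _ +%R 0 _ (@add_continuous R^o) _ _ _ c).
Qed.

End euclidean.

Section ray.
Context {R : realType} (d : nat).

Lemma is_derive_ray (f : 'rV[R]_d -> R) (y : 'rV[R]_d) (r : R) :
  differentiable f (r *: y) ->
  is_derive r 1 (fun t : R => f (t *: y)) (dotv (grad f (r *: y)) y).
Proof.
move=> df.
have E : (fun h : R => h^-1 *: (((fun t : R => f (t *: y)) \o shift r) (h *: 1) - f (r *: y)))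
       = (fun h : R => h^-1 *: ((f \o shift (r *: y)) (h *: y) - f (r *: y))).
  by apply/funext => h /=; rewrite scalerDl [h *: 1]mulr1.
have df' : derivable f (r *: y) y by exact: diff_derivable.
apply: DeriveDef.
  by rewrite /derivable E; exact: df'.
rewrite /derive E -/(derive f (r *: y) y) deriveE//.
have lin v : 'd f (r *: y) v = \sum_(i < d) v ord0 i * 'd f (r *: y) (delta_mx 0 i).
  rewrite {1}(row_sum_delta v) linear_sum/=.
  by apply: eq_bigr => i _; rewrite linearZ.
rewrite lin; apply: eq_bigr => i _.
by rewrite /grad mxE /partial deriveE// mulrC.
Qed.

(** Dissipativity at [t y], divided by [t], bounds the derivative of [f (t y)] below by
    [m t |y|^2 - b / t]. Subtracting a primitive of this bound leaves [psi], whose increment over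
    [[r, 1]] is nonnegative by the mean value theorem. *)
Lemma dissipative_ray (f : 'rV[R]_d -> R) (m b : R) (y : 'rV[R]_d) (r : R) :
  (forall z, differentiable f z) ->
  (forall z, m * enorm z ^+ 2 - b <= dotv (grad f z) z) ->
  0 < r < 1 ->
  m * (1 - r ^+ 2) / 2 * dotv y y + b * ln r <= f y - f (r *: y).
Proof.
move=> df dis /andP[r0 r1].
pose psi (t : R) := f (t *: y) - m / 2 * dotv y y * t ^+ 2 + b * ln t.
pose dpsi (t : R) := dotv (grad f (t *: y)) y - m * dotv y y * t + b / t.
have dP (t : R) : 0 < t -> is_derive t 1 psi (dpsi t).
  move=> t0.
  have d1 := is_derive_ray f y t (df _).
  have d2 : is_derive t 1 (fun t : R => m / 2 * dotv y y * t ^+ 2) (m * dotv y y * t).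
    by apply: is_derive_eq; rewrite /GRing.scale/=; field.
  have d3 : is_derive t 1 (fun t : R => b * ln t) (b / t).
    have dl := is_derive1_ln t0.
    by apply: is_derive_eq; rewrite /GRing.scale/=; ring.
  exact: (is_deriveD (is_deriveB d1 d2) d3).
have [||c cr E] := @MVT R psi dpsi r 1 r1 _ _.
- by move=> t; rewrite in_itv/= => /andP[rt _]; apply: dP; exact: lt_trans rt.
- apply: derivable_within_continuous => t; rewrite in_itv/= => /andP[rt _].
  exact: (@ex_derive _ _ _ _ _ _ _ (dP t (lt_le_trans r0 rt))).
have c0 : 0 < c by move: cr; rewrite in_itv/= => /andP[rc _]; exact: lt_trans rc.
have : 0 <= dpsi c.
  have := dis (c *: y); rewrite enorm_sqr !(dotvZl, dotvZr) => h.
  rewrite -(pmulr_rge0 _ c0) /dpsi mulrDr mulrBr (mulrCA c b) divff ?gt_eqF//.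
  lra.
move=> dc; have : 0 <= psi 1 - psi r by rewrite E mulr_ge0// subr_ge0 ltW.
rewrite /psi ln1 scale1r expr1n; lra.
Qed.

End ray.

(** * The Gaussian expectation as an integral *)

Section gauss_exp_representation.
Context {R : realType} (d : nat).
Notation mR := (measurableTypeR R).

Lemma iter_int_normal_prob_cst (s k : R) (ms : seq R) : 0 <= k ->
  iter_int [seq (normal_prob m s : set R -> \bar R) | m <- ms] (fun=> k%:E) = k%:E.
Proof.
move=> k0; elim: ms => [//|m ms IH] /=.
rewrite (_ : (fun _ => _) = cst k%:E); last by apply/funext => t; exact: IH.
rewrite (integral_measurableTypeR (normal_prob m s)) => [|//|t].
- rewrite integral_cst// [X in (_ * X)%E](_ : _ = 1%E) ?mule1//.
  exact: (@probability_setT _ mR R (normal_prob m s)).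
- by rewrite lee_fin.
Qed.

Lemma row_of_seq_scale (r : R) (ys : seq R) : size ys = d ->
  row_of_seq d [seq r * t | t <- ys] = r *: row_of_seq d ys.
Proof.
by move=> sy; apply/rowP => i; rewrite !mxE (nth_map 0) ?sy.
Qed.

Lemma nth_coords (x : 'rV[R]_d) (i : 'I_d) : nth 0 (coords x) i = x ord0 i.
Proof.
by rewrite (nth_map i) ?size_enum_ord// nth_ord_enum.
Qed.

(* Density, with respect to N(0, s2 I), of the image of N(x, s2 I) under
   [y |-> r^-1 y]. *)
Definition affine_weight (s2 r : R) (x y : 'rV[R]_d) : R :=
  r ^+ d * expR (((1 - r ^+ 2) * dotv y y + 2 * r * dotv x y - dotv x x) / (2 * s2)).

Lemma prod_gauss_weight (s r : R) (x : 'rV[R]_d) (y : d.-tuple R) : s != 0 ->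
  \prod_(i < d) gauss_weight s r (nth 0 (coords x) i) (tnth y i) =
  affine_weight (s ^+ 2) r x (row_of_seq d y).
Proof.
move=> s0; rewrite /affine_weight big_split/= prodr_const card_ord; congr (_ * _).
rewrite -expR_sum; congr expR; rewrite -mulr_suml; congr (_ / _).
rewrite /dotv !mulr_sumr -sumrN -!big_split/=; apply: eq_bigr => i _.
by rewrite nth_coords !mxE (tnth_nth 0); ring.
Qed.

(* Holds for the centred Gaussian of covariance s2 I: one measure serves all
   means [x], and for each [x] the scale [r] is free. *)
Definition gauss_reference (s2 : R) (P : probability (d.-tuple mR) R) : Prop :=
  forall (h : 'rV[R]_d -> R) (x : 'rV[R]_d) (r : R),
  continuous h -> (forall y, 0 <= h y) -> 0 < r ->
  (gauss_exp x s2 (fun y => (h y)%:E) =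
   \int[P]_y (h (r *: row_of_seq d (tval y)) *
              affine_weight s2 r x (row_of_seq d (tval y)))%:E)%E.

Lemma exists_gauss_exp_measure (s2 : R) : 0 < s2 ->
  exists P : probability (d.-tuple mR) R, gauss_reference s2 P.
Proof.
move=> s20; have s0 : Num.sqrt s2 != 0 by rewrite gt_eqF// sqrtr_gt0.
have [P HP] := exists_gauss_product _ d s0.
exists P => h x r ch h0 r0.
rewrite /gauss_exp (HP r)//; first last.
- by apply/measurable_EFinP; exact: measurable_continuous_row.
- by move=> ys; rewrite lee_fin.
- by rewrite size_map size_enum_ord.
apply: eq_integral => y _.
by rewrite prod_gauss_weight// sqr_sqrtr ?ltW// row_of_seq_scale ?size_tuple// EFinM.
Qed.

End gauss_exp_representation.

(** * The convexity criterion *)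

Lemma fine_le_EFin {R : realDomainType} (x : \bar R) (r : R) :
  (0 <= x)%E -> (x <= r%:E)%E -> fine x <= r.
Proof. by case: x => [z| |]. Qed.

Section convexity_criterion.
Context {R : realType} (d : nat).
Notation mR := (measurableTypeR R).
Variables (lam del : R) (P : probability (d.-tuple mR) R).
Hypotheses (lam_gt0 : 0 < lam) (del_gt0 : 0 < del).
Let s2 := lam * del.
Hypothesis gauss_expP : gauss_reference d s2 P.
Notation Y y := (row_of_seq d (tval y)).

Let s2_gt0 : 0 < s2. Proof. exact: mulr_gt0. Qed.

Lemma measurable_row_dotv (u : 'rV[R]_d) :
  measurable_fun [set: d.-tuple mR] (fun y => dotv u (Y y)).
Proof. by apply: (measurable_continuous_row d (dotv u)); exact: continuous_dotv. Qed.

Lemma measurable_row_dotvv :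
  measurable_fun [set: d.-tuple mR] (fun y => dotv (Y y) (Y y)).
Proof.
by apply: (measurable_continuous_row d (fun z => dotv z z)); exact: continuous_dotvv.
Qed.

(** No Gaussian integral is computed: the constant 1 has expectation 1 under the Gaussian of mean
    [theta / r], and the affine weight of scale [r] is the integrand up to the constant [a]. *)
Lemma integral_gauss_tilt (r : R) (theta : 'rV[R]_d) : 0 < r ->
  (\int[P]_y (expR (((1 - r ^+ 2) * dotv (Y y) (Y y) + 2 * dotv theta (Y y)) / (2 * s2)))%:E
   = ((r ^+ d)^-1 * expR (dotv theta theta / (2 * r ^+ 2 * s2)))%:E)%E.
Proof.
move=> r0; have rd : 0 < r ^+ d by rewrite exprn_gt0.
have c1 : continuous (fun _ : 'rV[R]_d => 1 : R) by apply: cst_continuous.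
have := gauss_expP _ (r^-1 *: theta) r c1 (fun=> ler01) r0.
rewrite /gauss_exp iter_int_normal_prob_cst//.
set a := (r ^+ d)^-1 * _.
set I := (X in _ -> X = _).
have -> : (\int[P]_y (1 * affine_weight d s2 r (r^-1 *: theta) (Y y))%:E = (a^-1)%:E * I)%E.
  rewrite -ge0_integralZl//; last 2 first.
  - apply/measurable_EFinP; apply: measurableT_comp => //.
    apply: measurable_funM => //; apply: measurable_funD.
      by apply: measurable_funM => //; exact: measurable_row_dotvv.
    by apply: measurable_funM => //; exact: measurable_row_dotv.
  - by rewrite lee_fin invr_ge0 mulr_ge0 ?expR_ge0// invr_ge0 ltW.
  apply: eq_integral => y _; rewrite -EFinM; congr (_%:E).
  have -> : a^-1 = r ^+ d * expR (- (dotv theta theta / (2 * r ^+ 2 * s2))).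
    by rewrite /a [LHS]invfM invrK expRN.
  rewrite mul1r /affine_weight -[RHS]mulrA -expRD.
  congr (_ * expR _); rewrite !(dotvZl, dotvZr); field.
  by rewrite !gt_eqF.
have a0 : a != 0 by rewrite gt_eqF// mulr_gt0 ?expR_gt0// invr_gt0.
move=> E; have : (a%:E * 1 = a%:E * ((a^-1)%:E * I))%E by rewrite -E.
by rewrite mule1 muleA -EFinM divff// mul1e => ->.
Qed.

Variables (f : 'rV[R]_d -> R) (f0 : R).
Hypotheses (cf : continuous f) (f_ge : forall y, f0 <= f y).

(** Up to the factor [exp (- |z|^2 / (2 s2))], this is [exp (- f / del)] times the density of N(z,
    s2 I) with respect to N(0, s2 I). *)
Definition gibbs_weight (z : 'rV[R]_d) (y : d.-tuple mR) : R :=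
  expR (- f (Y y) / del + dotv z (Y y) / s2).

Lemma gibbs_weight_gt0 z y : 0 < gibbs_weight z y.
Proof. exact: expR_gt0. Qed.

Lemma measurable_gibbs_weight z : measurable_fun [set: d.-tuple mR] (gibbs_weight z).
Proof.
apply: measurableT_comp => //; apply: measurable_funD.
  apply: measurable_funM => //; apply: measurableT_comp => //.
  exact: measurable_continuous_row.
by apply: measurable_funM => //; exact: measurable_row_dotv.
Qed.

Lemma integrable_gibbs_weight z :
  P.-integrable [set: d.-tuple mR] (EFin \o gibbs_weight z).
Proof.
apply/integrableP; split.
  by apply/measurable_EFinP; exact: measurable_gibbs_weight.
under eq_integral do rewrite /= ger0_norm ?expR_ge0//.
(* The vanishing coefficient [1 - 1 ^+ 2] puts the majorant in the form of [integral_gauss_tilt] at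
   scale 1. *)
pose g (y : d.-tuple mR) := expR (((1 - 1 ^+ 2) * dotv (Y y) (Y y) + 2 * dotv z (Y y)) / (2 * s2)).
have mg : measurable_fun [set: d.-tuple mR] (EFin \o g).
  apply/measurable_EFinP; apply: measurableT_comp => //.
  apply: measurable_funM => //; apply: measurable_funD.
    by apply: measurable_funM => //; exact: measurable_row_dotvv.
  by apply: measurable_funM => //; exact: measurable_row_dotv.
apply: (@le_lt_trans _ _ (\int[P]_y ((expR (- f0 / del))%:E * (g y)%:E))%E).
  apply: ge0_le_integral => //.
  - by move=> y _; rewrite lee_fin expR_ge0.
  - by apply/measurable_EFinP; exact: measurable_gibbs_weight.
  - by apply: emeasurable_funM => //; exact: measurable_cst.
  - move=> y _; rewrite -EFinM lee_fin -expRD ler_expR lerD//.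
      by rewrite ler_pM2r ?invr_gt0// lerN2.
    by rewrite expr1n subrr mul0r add0r -mulf_div divff ?mul1r.
rewrite ge0_integralZl//; last by move=> y _; rewrite lee_fin expR_ge0.
by rewrite integral_gauss_tilt// -EFinM ltry.
Qed.

Let Z z := \int[P]_y gibbs_weight z y.

Lemma integral_gibbs_weight z : (\int[P]_y (gibbs_weight z y)%:E = (Z z)%:E)%E.
Proof. by rewrite /Z /Rintegral fineK// integrable_fin_num// integrable_gibbs_weight. Qed.

Let P_neq0 : P setT != 0%E. Proof. by rewrite probability_setT. Qed.

Lemma gibbs_weight_line y0 u (t : R) y :
  gibbs_weight (y0 + t *: u) y = expR (t * (dotv u (Y y) / s2)) * gibbs_weight y0 y.
Proof.
rewrite /gibbs_weight -expRD dotvDl dotvZl; congr expR; field.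
by rewrite !gt_eqF.
Qed.

(** Moving [z] along [u] only tilts the weight exponentially, so the normalisation along a line is a
    Laplace transform. *)
Lemma lap_gibbs_weight y0 u t :
  lap P (fun y => dotv u (Y y) / s2) (gibbs_weight y0) 0 t = Z (y0 + t *: u).
Proof.
apply: eq_Rintegral => y _.
by rewrite /lap_integrand expr0 mul1r gibbs_weight_line.
Qed.

Let mw u : measurable_fun [set: d.-tuple mR] (fun y => dotv u (Y y) / s2).
Proof. by apply: measurable_funM => //; exact: measurable_row_dotv. Qed.

Let int_exp y0 u (t : R) : P.-integrable [set: d.-tuple mR]
  (fun y => (expR (t * (dotv u (Y y) / s2)) * gibbs_weight y0 y)%:E).
Proof.
rewrite (_ : (fun _ => _) = EFin \o gibbs_weight (y0 + t *: u)).
  exact: integrable_gibbs_weight.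
by apply/funext => y; rewrite /= gibbs_weight_line.
Qed.

Lemma integral_gibbs_weight_gt0 z : 0 < Z z.
Proof.
have <- : lap P (fun y => dotv 0 (Y y) / s2) (gibbs_weight z) 0 0 = Z z.
  by rewrite lap_gibbs_weight scale0r addr0.
apply: (lap0_gt0 P _ _ (mw 0) (measurable_gibbs_weight z) (gibbs_weight_gt0 z) (int_exp z 0)).
exact: P_neq0.
Qed.

Lemma soft_moreauE z :
  soft_moreau f lam del z = dotv z z / (2 * lam) - del * ln (Z z).
Proof.
have ch : continuous (fun y => expR (- f y / del)).
  move=> y; apply: continuous_comp; last exact: continuous_expR.
  exact: (cvgM (cvgN (cf y)) (cvg_cst _)).
have h0 (y : 'rV[R]_d) : 0 <= expR (- f y / del) by exact: expR_ge0.
rewrite /soft_moreau (gauss_expP _ z 1 ch h0 ltr01).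
set c := expR (- (dotv z z / (2 * s2))).
have -> : (\int[P]_y (expR (- f (1 *: Y y) / del) * affine_weight d s2 1 z (Y y))%:E
    = c%:E * \int[P]_y (gibbs_weight z y)%:E)%E.
  rewrite -ge0_integralZl//; last 3 first.
  - by apply/measurable_EFinP; exact: measurable_gibbs_weight.
  - by move=> y _; rewrite lee_fin expR_ge0.
  - by rewrite lee_fin expR_ge0.
  apply: eq_integral => y _; rewrite -EFinM; congr (_%:E).
  rewrite /affine_weight expr1n mul1r scale1r /c /gibbs_weight -!expRD.
  by congr expR; field; rewrite !gt_eqF.
rewrite integral_gibbs_weight -EFinM/= lnM ?posrE ?expR_gt0 ?integral_gibbs_weight_gt0// expRK.
rewrite /s2; field.
by rewrite !gt_eqF.
Qed.

(** This is [convex_sub_ln_lap] with [C = |u|^2 / s2], multiplied by [del]: the quadratic term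
    becomes [t^2 |u|^2 / (2 lam)], and the rest of [|y + t u|^2 / (2 lam)] is affine in [t]. *)
Lemma soft_moreau_convex_segment (x y : 'rV[R]_d) (t : R) :
  (forall s, 0 < s < 1 -> exists c,
    (\int[P]_z ((dotv (x - y)%R (Y z) / s2 - c) ^+ 2 *
                gibbs_weight (s *: x + (1 - s) *: y) z)%:E
     <= (dotv (x - y)%R (x - y)%R / s2 * Z (s *: x + (1 - s) *: y))%:E)%E) ->
  0 <= t <= 1 ->
  soft_moreau f lam del (t *: x + (1 - t) *: y) <=
  t * soft_moreau f lam del x + (1 - t) * soft_moreau f lam del y.
Proof.
move=> var t01; set u := x - y.
have lineE (s : R) : s *: x + (1 - s) *: y = y + s *: u.
  by apply/rowP => i; rewrite /u !mxE; ring.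
have xE : y + 1 *: u = x by rewrite scale1r /u subrKC.
have h := convex_sub_ln_lap P _ _ (mw u) (measurable_gibbs_weight y)
  (gibbs_weight_gt0 y) (int_exp y u) (dotv u u / s2) t P_neq0 _ t01.
have {}h : dotv u u / s2 / 2 * t ^+ 2 - ln (Z (y + t *: u)) <=
    t * (dotv u u / s2 / 2 - ln (Z x)) - (1 - t) * ln (Z y).
  rewrite !lap_gibbs_weight xE scale0r addr0 in h; apply: h => s s01.
  have [c hc] := var s s01; exists c; rewrite lap_gibbs_weight -lineE.
  have e (z : d.-tuple mR) :
      expR (s * (dotv u (Y z) / s2)) * gibbs_weight y z =
      gibbs_weight (s *: x + (1 - s) *: y) z by rewrite lineE gibbs_weight_line.
  rewrite /Rintegral; under eq_integral do rewrite e.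
  apply: fine_le_EFin hc; apply: integral_ge0 => z _.
  by rewrite lee_fin mulr_ge0 ?sqr_ge0// expR_ge0.
have dE (s : R) := dotv_line y u s.
have := dE 1; rewrite xE => xxE.
rewrite lineE !soft_moreauE dE xxE.
have := ler_wpM2l (ltW del_gt0) h.
rewrite (_ : del * (dotv u u / s2 / 2 * t ^+ 2 - ln (Z (y + t *: u))) =
  t ^+ 2 * dotv u u / (2 * lam) - del * ln (Z (y + t *: u))); last first.
  by rewrite /s2; field; rewrite !gt_eqF.
rewrite (_ : del * (t * (dotv u u / s2 / 2 - ln (Z x)) - (1 - t) * ln (Z y)) =
  t * dotv u u / (2 * lam) - t * (del * ln (Z x)) - (1 - t) * (del * ln (Z y))); last first.
  by rewrite /s2; field; rewrite !gt_eqF.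
set k := (2 * lam)^-1.
move: (ln _) (ln _) (ln _) (dotv u u) (dotv y u) (dotv y y) => l1 l2 l3 c b a.
lra.
Qed.
End convexity_criterion.

(** * Second moment bounds *)

(** The passage to the limit [h -> 0] in the two second moment bounds. *)
Lemma le_linear_error {R : realFieldType} (a b k h0 : R) : 0 < h0 -> 0 <= k ->
  (forall h, 0 < h < h0 -> a <= b + k * h) -> a <= b.
Proof.
move=> h00 k0 H; apply/ler_addgt0Pr => e e0.
have k1 : 0 < k + 1 by rewrite ltr_wpDl.
pose h := Num.min (h0 / 2) (e / (k + 1)).
have h_gt0 : 0 < h by rewrite lt_min !divr_gt0.
have hh0 : h < h0.
  by rewrite gt_min ltr_pdivrMr// ltr_pMr// ltr1n.
have he : h * (k + 1) <= e by rewrite -ler_pdivlMr// ge_min lexx orbT.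
have := H h; rewrite h_gt0 hh0 => /(_ isT) le1.
apply: (le_trans le1); rewrite lerD2l; apply: le_trans he.
by rewrite mulrC ler_wpM2l ?(ltW h_gt0)// lerDl.
Qed.

(** Linearises by [1 - x <= e^-x], which may be multiplied by [z + eps * a] when [eps * a >= 0];
    otherwise the left side is at most 0 and the right side at least 0. *)
Lemma le_of_expR_decay {R : realType} (a z k h0 eps : R) : 0 <= z -> 0 <= k ->
  k * h0 < 1 -> 0 <= eps -> 0 <= h0 ->
  expR (- (k * h0)) * (z + eps * a) <= z -> (1 - k * h0) * (eps * a) <= k * h0 * z.
Proof.
move=> z0 k0 kh e0 h00 H.
have e1 := expR_ge1Dx (- (k * h0)).
have [ea|/ltW ea] := leP 0 (eps * a); last first.
  apply: (@le_trans _ _ 0); last by rewrite !mulr_ge0.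
  by rewrite mulr_ge0_le0// subr_ge0 ltW.
have : (1 - k * h0) * (z + eps * a) <= z.
  apply: le_trans H; rewrite ler_wpM2r// addr_ge0//.
rewrite mulrDr mulrBl mul1r; lra.
Qed.

Section ge0_integral_real.
Context {R : realType} {d} {T : measurableType d} (mu : {measure set T -> \bar R}).

Lemma ge0_integral_EFinZl (k : R) (g : T -> R) : measurable_fun [set: T] g ->
  (forall y, 0 <= g y) -> 0 <= k ->
  (\int[mu]_y (k * g y)%:E = k%:E * \int[mu]_y (g y)%:E)%E.
Proof.
move=> mg g0 k0; rewrite -ge0_integralZl_EFin//.
- by move=> y _; rewrite lee_fin.
- exact/measurable_EFinP.
Qed.

Lemma ge0_integral_EFinD (g h : T -> R) :
  measurable_fun [set: T] g -> measurable_fun [set: T] h ->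
  (forall y, 0 <= g y) -> (forall y, 0 <= h y) ->
  (\int[mu]_y (g y + h y)%:E = \int[mu]_y (g y)%:E + \int[mu]_y (h y)%:E)%E.
Proof.
move=> mg mh g0 h0; rewrite -ge0_integralD//.
- by move=> y _; rewrite lee_fin.
- exact/measurable_EFinP.
- by move=> y _; rewrite lee_fin.
- exact/measurable_EFinP.
Qed.

Lemma ge0_le_integral_EFin (g h : T -> R) :
  measurable_fun [set: T] g -> measurable_fun [set: T] h ->
  (forall y, 0 <= g y) -> (forall y, g y <= h y) ->
  (\int[mu]_y (g y)%:E <= \int[mu]_y (h y)%:E)%E.
Proof.
move=> mg mh g0 gh; apply: ge0_le_integral => //.
- by move=> y _; rewrite lee_fin.
- exact/measurable_EFinP.
- by apply/measurable_EFinP.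
- by move=> y _; rewrite lee_fin.
Qed.

End ge0_integral_real.

Section second_moment.
Context {R : realType} (d : nat).
Notation mR := (measurableTypeR R).
Variables (lam del : R) (P : probability (d.-tuple mR) R).
Hypotheses (lam_gt0 : 0 < lam) (del_gt0 : 0 < del).
Let s2 := lam * del.
Hypothesis gauss_expP : gauss_reference d s2 P.
Notation Y y := (row_of_seq d (tval y)).
Variables (f : 'rV[R]_d -> R) (f0 : R).
Hypotheses (cf : continuous f) (f_ge : forall y, f0 <= f y).
Let gw := gibbs_weight d lam del f.
Let s2_gt0 : 0 < s2. Proof. exact: mulr_gt0. Qed.

Let continuous_expR_div (g : 'rV[R]_d -> R) : continuous g ->
  continuous (fun v => expR (- g v / del)).
Proof.
move=> cg v; apply: continuous_comp; last exact: continuous_expR.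
exact: (cvgM (cvgN (cg v)) (cvg_cst _)).
Qed.

Lemma dissipative_second_moment (m b : R) (z : 'rV[R]_d) :
  (forall y, differentiable f y) -> 0 < m -> 0 <= b ->
  (forall y, m * enorm y ^+ 2 - b <= dotv (grad f y) y) ->
  (((m / del + (2 * s2)^-1)%:E * \int[P]_y (dotv (Y y) (Y y) * gw z y)%:E
   <= ((d%:R + b / del + dotv z z / (2 * s2)) * \int[P]_y gw z y)%:E))%E.
Proof.
move=> df m0 b0 dis.
set a := m / del + (2 * s2)^-1; set p := d%:R + b / del + dotv z z / (2 * s2).
have a0 : 0 < a by rewrite addr_gt0 ?divr_gt0// invr_gt0 mulr_gt0.
have zz0 := dotv_ge0 z.
have p0 : 0 <= p.
  by rewrite !addr_ge0 ?ler0n ?divr_ge0 ?mulr_ge0// ltW.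
set A := (\int[P]_y _)%E; set Z := \int[P]_y _.
have Z0 : 0 <= Z by apply: Rintegral_ge0 => y _; exact: expR_ge0.
have A0 : (0 <= A)%E.
  by apply: integral_ge0 => y _; rewrite lee_fin mulr_ge0 ?dotv_ge0// expR_ge0.
have ZE : (\int[P]_y (gw z y)%:E = Z%:E)%E.
  exact: (integral_gibbs_weight d lam del P lam_gt0 del_gt0 gauss_expP f f0 cf f_ge).
have mgw : measurable_fun [set: d.-tuple mR] (gw z).
  exact: (measurable_gibbs_weight d lam del f cf z).
(* Rescaling by [r = e^-h] leaves the normalisation [Z] unchanged, while
   dissipativity along rays makes the rescaled density at least
   [e^-(K h) (1 + eps r |y|^2)] times the original one; dividing by [h] and
   letting [h] tend to 0 bounds the second moment. *)
pose eps r := (m / del) * (1 - r ^+ 2) / 2 + (1 - r ^+ 2) / (2 * s2) - (1 - r) / (2 * s2).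
pose K h := b * h / del + (1 - expR (- h)) * dotv z z / (2 * s2).
have mgw2 : measurable_fun [set: d.-tuple mR] (fun y => dotv (Y y) (Y y) * gw z y).
  by apply: measurable_funM => //; exact: measurable_row_dotvv.
have gw0 y : 0 <= gw z y by exact: expR_ge0.
have gw20 y : 0 <= dotv (Y y) (Y y) * gw z y by rewrite mulr_ge0 ?dotv_ge0.
have mW (r : R) : 0 < r -> measurable_fun [set: d.-tuple mR] (fun y =>
    expR (- f (r *: Y y) / del) * affine_weight d s2 r z (Y y)).
  move=> r0; apply: measurable_funM.
    apply: (measurable_continuous_row d (fun v => expR (- f (r *: v) / del))).
    apply: continuous_expR_div => v.
    by apply: continuous_comp; [exact: scaler_continuous|exact: cf].
  apply: measurable_funM => //; apply: measurableT_comp => //.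
  apply: measurable_funM => //; apply: measurable_funB => //; apply: measurable_funD.
    by apply: measurable_funM => //; exact: measurable_row_dotvv.
  by apply: measurable_funM => //; exact: measurable_row_dotv.
have W0 (r : R) y : 0 < r -> 0 <= expR (- f (r *: Y y) / del) * affine_weight d s2 r z (Y y).
  by move=> r0; rewrite !mulr_ge0 ?expR_ge0// exprn_ge0// ltW.
have ch := continuous_expR_div f cf.
have h0' (y : 'rV[R]_d) : 0 <= expR (- f y / del) by exact: expR_ge0.
pose c0 := expR (- (dotv z z / (2 * s2))).
have c00 : 0 < c0 by exact: expR_gt0.
have key h : 0 < h < 1 -> 0 <= eps (expR (- h)) ->
    ((expR (- h) ^+ d * expR (- K h))%:E * (Z%:E + (eps (expR (- h)))%:E * A) <= Z%:E)%E.
  move=> /andP[h0 h1] eps0; set r := expR (- h).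
  have r0 : 0 < r by exact: expR_gt0.
  have r1 : r < 1 by rewrite expR_lt1 oppr_lt0.
  (* Scales 1 and [r] compute the same Gaussian expectation; scale 1 gives [c0 * Z]. *)
  have E1 : (c0%:E * Z%:E = \int[P]_y (expR (- f (r *: Y y) / del) *
      affine_weight d s2 r z (Y y))%:E)%E.
    rewrite -(gauss_expP _ z r ch h0' r0) (gauss_expP _ z 1 ch h0' ltr01).
    rewrite -ZE -ge0_integral_EFinZl ?ltW//.
    apply: eq_integral => y _; congr (_%:E).
    rewrite /affine_weight !expr1n mul1r scale1r /c0 /gw /gibbs_weight -!expRD.
    by congr expR; rewrite -/s2; field; rewrite !gt_eqF.
  pose W (y : d.-tuple mR) := expR (- f (r *: Y y) / del) * affine_weight d s2 r z (Y y).
  have E2 : (Z%:E = \int[P]_y (c0^-1 * W y)%:E)%E.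
    rewrite ge0_integral_EFinZl.
    - by rewrite -E1 -EFinM mulKf ?gt_eqF.
    - exact: mW.
    - by move=> y; exact: W0.
    - by rewrite invr_ge0 ltW.
  have k0 : 0 <= r ^+ d * expR (- K h) by rewrite mulr_ge0 ?expR_ge0// exprn_ge0// ltW.
  have mE : measurable_fun [set: d.-tuple mR] (fun y => eps r * (dotv (Y y) (Y y) * gw z y)).
    exact: measurable_funM.
  have E3 : ((r ^+ d * expR (- K h))%:E * (Z%:E + (eps r)%:E * A) =
      \int[P]_y (r ^+ d * expR (- K h) *
        (gw z y + eps r * (dotv (Y y) (Y y) * gw z y)))%:E)%E.
    rewrite ge0_integral_EFinZl//.
    - rewrite ge0_integral_EFinD//; last by move=> y; rewrite mulr_ge0.
      by rewrite ge0_integral_EFinZl// ZE.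
    - exact: measurable_funD.
    - by move=> y; rewrite addr_ge0// mulr_ge0.
  rewrite E3 [leRHS]E2; apply: ge0_le_integral_EFin.
  - by apply: measurable_funM => //; exact: measurable_funD.
  - by apply: measurable_funM => //; exact: mW.
  - by move=> y; rewrite mulr_ge0// addr_ge0// mulr_ge0.
  move=> y; rewrite /W /affine_weight /c0 -expRN opprK.
  set v := Y y.
  rewrite [leRHS](_ : _ = r ^+ d * expR (- f (r *: v) / del +
    ((1 - r ^+ 2) * dotv v v + 2 * r * dotv z v - dotv z z) / (2 * s2) +
    dotv z z / (2 * s2))); last by rewrite !expRD; ring.
  rewrite -mulrA ler_pM2l ?exprn_gt0//.
  apply: (@le_trans _ _ (expR (- K h) * (gw z y * expR (eps r * dotv v v)))).
    rewrite ler_pM2l ?expR_gt0// mulrA [leLHS](_ : _ = gw z y * (1 + eps r * dotv v v)); last by ring.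
    by rewrite ler_wpM2l// expR_ge1Dx.
  rewrite /gw /gibbs_weight -!expRD ler_expR -/v -/s2.
  (* Here [ln r = - h] yields the [b h / del] of [K]. The change [(1 - r) <z, v> / s2] in the linear
     term is split by [2 <z, v> <= |z|^2 + |v|^2]: one half goes to [K], the other is the loss in
     [eps]. *)
  have ray := dissipative_ray d f m b v r df dis; rewrite r0 r1 in ray.
  have {}ray := ray isT; rewrite /r expRK -/r in ray.
  have dl := dotv_le z v.
  have D0 : 0 <= del^-1 by rewrite invr_ge0 ltW.
  have S0 : 0 <= (2 * s2)^-1 by rewrite invr_ge0 mulr_ge0// ltW.
  have r1' : 0 <= 1 - r by rewrite subr_ge0 ltW.
  have i1 := ler_wpM2r D0 ray.
  have i2 := ler_wpM2r S0 (ler_wpM2l r1' dl).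
  have -> : dotv z v / s2 = 2 * dotv z v * (2 * s2)^-1 by field; rewrite gt_eqF.
  rewrite /K /eps -/r.
  move: (2 * s2)^-1 (del^-1) S0 D0 i1 i2 => S D S0 D0 i1 i2.
  lra.
have epsE r : eps r = (1 - r) * (m / del * ((1 + r) / 2) + r * (2 * s2)^-1).
  by rewrite /eps; field; rewrite !gt_eqF.
have mD0 : 0 < m / del by rewrite divr_gt0.
have S0 : 0 < (2 * s2)^-1 by rewrite invr_gt0 mulr_gt0.
(* To first order [eps (e^-h)] is [h * a]; the bound comes from [1 - h <= e^-h <= 1 / (1 + h)]. *)
have eps_ge h : 0 < h < 1 -> h * (1 - h) ^+ 2 * a <= eps (expR (- h)).
  move=> /andP[h0 h1]; rewrite epsE; set r := expR (- h).
  have r_ge : 1 - h <= r by exact: expR_ge1Dx.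
  have r0 : 0 < r by exact: expR_gt0.
  have r1 : r < 1 by rewrite expR_lt1 oppr_lt0.
  have rh : r * (1 + h) <= 1.
    rewrite /r expRN mulrC ler_pdivrMr ?expR_gt0// mul1r; exact: expR_ge1Dx.
  have r_le : h * (1 - h) <= 1 - r by nra.
  have i1 : (1 - h) * a <= m / del * ((1 + r) / 2) + r * (2 * s2)^-1.
    have j1 : m / del * (1 - h) <= m / del * ((1 + r) / 2).
      by rewrite ler_pM2l//; lra.
    have j2 : (1 - h) * (2 * s2)^-1 <= r * (2 * s2)^-1 by rewrite ler_pM2r.
    by rewrite /a; lra.
  rewrite (_ : h * (1 - h) ^+ 2 * a = h * (1 - h) * ((1 - h) * a)); last by ring.
  by apply: ler_pM => //; rewrite !mulr_ge0 ?subr_ge0 ?(ltW h0) ?(ltW h1) ?(ltW a0).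
have eps_gt0 h : 0 < h < 1 -> 0 < eps (expR (- h)).
  move=> h01; apply: lt_le_trans (eps_ge h h01); have /andP[h0 h1] := h01.
  by do 2 ?apply: mulr_gt0 => //; rewrite exprn_gt0// subr_gt0.
(* [key] at [h = 1/2] excludes an infinite moment, since its right side is finite. *)
have [A' AE] : exists A' : R, A = A'%:E.
  have h01 : 0 < (2^-1 : R) < 1 by apply/andP; split; lra.
  have e0 := eps_gt0 _ h01; have := key _ h01 (ltW e0).
  case: (A) A0 => [A' _ _| _ |//]; first by exists A'.
  rewrite gt0_muley ?lte_fin// addey// gt0_muley ?lte_fin//.
  by rewrite mulr_gt0 ?expR_gt0// exprn_gt0 ?expR_gt0.
have A'0 : 0 <= A' by rewrite -lee_fin -AE.
rewrite AE -EFinM lee_fin.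
have aA0 : 0 <= a * A' by rewrite mulr_ge0// ltW.
have p10 : 0 < (1 + p)^-1 by rewrite invr_gt0 ltr_wpDr.
(* The range [h < 1 / (1 + p)] ensures [h < 1] and [p h < 1]; the slope comes from
   [(1 - h)^2 (1 - p h) >= 1 - (2 + p) h]. *)
apply: (@le_linear_error _ _ _ ((2 + p) * (a * A')) (1 + p)^-1) => //.
  by rewrite mulr_ge0// addr_ge0.
move=> h /andP[h0]; rewrite -[ltRHS]mul1r ltr_pdivlMr ?ltr_wpDr// mulrDr mulr1 => hp.
have hp0 : 0 <= h * p by rewrite mulr_ge0// ltW.
have h01 : 0 < h < 1 by rewrite h0/=; lra.
have e0 := eps_gt0 _ h01; have := key _ h01 (ltW e0).
rewrite AE -[X in (_ * (_ + X))%E]EFinM -EFinD -EFinM lee_fin => H.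
(* [d h + K h <= p h], because [1 - e^-h <= h]. *)
have {}H : expR (- (p * h)) * (Z + eps (expR (- h)) * A') <= Z.
  apply: le_trans H; rewrite ler_wpM2r//.
    by rewrite addr_ge0// mulr_ge0// ltW.
  rewrite -expRM_natl -expRD ler_expR /K.
  have r_ge : 1 - expR (- h) <= h by have := expR_ge1Dx (- h); lra.
  have i1 := ler_wpM2r (mulr_ge0 zz0 (ltW S0)) r_ge.
  by rewrite /p; lra.
have ph : p * h < 1 by lra.
have {}H := le_of_expR_decay A' Z p h (eps (expR (- h))) Z0 p0 ph (ltW e0) (ltW h0) H.
have H2 : h * ((1 - h) ^+ 2 * (1 - p * h) * (a * A')) <= h * (p * Z).
  apply: le_trans (_ : (1 - p * h) * (eps (expR (- h)) * A') <= _); last lra.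
  rewrite (_ : h * _ = (1 - p * h) * (h * (1 - h) ^+ 2 * a * A')); last by ring.
  rewrite ler_wpM2l//; first lra.
  by rewrite ler_wpM2r// eps_ge.
move: H2; rewrite ler_pM2l// => H2.
have : (1 - (2 + p) * h) * (a * A') <= (1 - h) ^+ 2 * (1 - p * h) * (a * A').
  rewrite ler_wpM2r//; nra.
lra.
Qed.

End second_moment.

(** [e^x + e^-x - 2] is the square of [e^(x/2) - e^(-x/2)], and [2 y <= e^y - e^-y] for [y >= 0]
    since the difference has nonnegative derivative. *)
Lemma sqr_le_expR {R : realType} (x : R) : x ^+ 2 + 2 <= expR x + expR (- x).
Proof.
have pos (y : R) : 0 <= y -> 2 * y <= expR y - expR (- y).
  move=> y0; pose g (t : R) := expR t - expR (- t) - 2 * t.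
  have dg (t : R) : is_derive t 1 g (expR t + expR (- t) - 2).
    apply: is_derive_eq; rewrite /GRing.scale/=; ring.
  have g00 : g 0 = 0 by rewrite /g oppr0 subrr mulr0 subrr.
  have [|c _ E] := @MVT_segment R g _ 0 y y0 (fun t _ => dg t).
    apply: derivable_within_continuous => t _.
    exact: (@ex_derive _ _ _ _ _ _ _ (dg t)).
  have := expR_ge1Dx c; have := expR_ge1Dx (- c) => e1 e2.
  have : 0 <= g y - g 0 by rewrite E mulr_ge0// ?subr0//; lra.
  by rewrite g00 /g; lra.
pose y := `|x| / 2.
have y0 : 0 <= y by rewrite divr_ge0.
have h := pos y y0.
have e : expR y * expR (- y) = 1 by rewrite -expRD subrr expR0.
have -> : expR x + expR (- x) = expR `|x| + expR (- `|x|).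
  by case: ger0P => _ //; rewrite opprK addrC.
have -> : `|x| = y + y by rewrite /y -splitr.
have -> : x ^+ 2 = (2 * y) ^+ 2 by rewrite /y mulrC divfK// real_normK// num_real.
rewrite opprD !expRD.
have : (2 * y) ^+ 2 <= (expR y - expR (- y)) ^+ 2.
  by rewrite ler_sqr ?nnegrE ?mulr_ge0// (le_trans _ h)// mulr_ge0.
nra.
Qed.

(** * Second moments for a quadratic potential *)

Section gaussian_second_moment.
Context {R : realType} (d : nat).
Notation mR := (measurableTypeR R).
Variables (lam del : R) (P : probability (d.-tuple mR) R).
Hypotheses (lam_gt0 : 0 < lam) (del_gt0 : 0 < del).
Let s2 := lam * del.
Hypothesis gauss_expP : gauss_reference d s2 P.
Notation Y y := (row_of_seq d (tval y)).
Variable kappa : R.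
Hypothesis kappa_gt0 : 0 < kappa.
Let s2_gt0 : 0 < s2. Proof. exact: mulr_gt0. Qed.
(** For the potential [kappa / 2 |y|^2], the Gibbs measure at [z] is Gaussian with mean [rho z] and
    covariance [rho s2 I]. *)
Let rho := (1 + kappa * lam)^-1.
Let rho_gt0 : 0 < rho. Proof. by rewrite invr_gt0 addr_gt0// mulr_gt0. Qed.
Let G := gibbs_weight d lam del (fun y : 'rV[R]_d => kappa / 2 * dotv y y).
Let quad_continuous : continuous (fun y : 'rV[R]_d => kappa / 2 * dotv y y).
Proof. by move=> z; exact: (cvgM (cvg_cst _) (continuous_dotvv d z)). Qed.

(** The scale [r] with [r^2 = 1 + kappa lam] turns the quadratic potential into the [1 - r^2] term
    of [integral_gauss_tilt]; [M] gathers the factors free of [u]. *)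
Lemma integral_quadratic_gibbs (z : 'rV[R]_d) : exists2 M : R, 0 < M &
  forall u : 'rV[R]_d,
  (\int[P]_y (G (z + u)%R y)%:E =
   (M * expR (rho * (2 * dotv z u + dotv u u) / (2 * s2)))%:E)%E.
Proof.
pose r := Num.sqrt (1 + kappa * lam).
have r2 : r ^+ 2 = 1 + kappa * lam by rewrite sqr_sqrtr// ltW// addr_gt0// mulr_gt0.
have r0 : 0 < r by rewrite sqrtr_gt0 addr_gt0// mulr_gt0.
exists ((r ^+ d)^-1 * expR (rho * dotv z z / (2 * s2))).
  by rewrite mulr_gt0 ?expR_gt0// invr_gt0 exprn_gt0.
move=> u.
transitivity (\int[P]_y (expR (((1 - r ^+ 2) * dotv (Y y) (Y y) +
    2 * dotv (z + u)%R (Y y)) / (2 * s2)))%:E)%E.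
  apply: eq_integral => y _; congr (_%:E); congr expR; rewrite r2 /s2; field.
  by rewrite !gt_eqF.
rewrite (integral_gauss_tilt d lam del P lam_gt0 del_gt0 gauss_expP)//.
congr (_%:E); rewrite -[RHS]mulrA -expRD; congr (_ * expR _).
rewrite !(dotvDl, dotvDr) (dotvC u z) r2 /rho -/s2; field.
by rewrite !gt_eqF// addr_gt0// mulr_gt0.
Qed.

Lemma quadratic_second_moment (z u : 'rV[R]_d) :
  (\int[P]_y ((dotv u (Y y) / s2 - rho * dotv z u / s2) ^+ 2 * G z y)%:E
   <= (rho * dotv u u / s2)%:E * \int[P]_y (G z y)%:E)%E.
Proof.
have [M M0 GE] := integral_quadratic_gibbs z.
set c := rho * dotv z u / s2.
have GzE : (\int[P]_y (G z y)%:E = M%:E)%E.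
  have := GE 0; rewrite addr0 => ->; congr (_%:E).
  have -> : (0 : 'rV[R]_d) = 0 *: u by rewrite scale0r.
  by rewrite !(dotvZl, dotvZr) !mul0r !mulr0 addr0 mulr0 mul0r expR0 mulr1.
rewrite GzE; set A := (\int[P]_y _)%E.
pose k := rho * dotv u u / (2 * s2).
have uu0 := dotv_ge0 u.
have k0 : 0 <= k by rewrite divr_ge0 ?mulr_ge0// ltW.
have mG v : measurable_fun [set: d.-tuple mR] (G v).
  exact: (measurable_gibbs_weight d lam del _ quad_continuous v).
have mw : measurable_fun [set: d.-tuple mR] (fun y => (dotv u (Y y) / s2 - c) ^+ 2 * G z y).
  apply: measurable_funM => //; apply: measurable_funX; apply: measurable_funB => //.
  by apply: measurable_funM => //; exact: measurable_row_dotv.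
have G0 v y : 0 <= G v y by exact: expR_ge0.
(* x^2 <= e^x + e^-x - 2 at x = h (w - c), with w = <u, y> / s2, turns the
   variance into a difference of exponential moments, which are explicit;
   [h] then tends to 0. *)
have key g : 0 < g -> (g%:E * A + (2 * M)%:E <= (2 * M * expR (k * g))%:E)%E.
  move=> g0; pose h := Num.sqrt g; have hh : h ^+ 2 = g by rewrite sqr_sqrtr// ltW.
  have L : (g%:E * A + (2 * M)%:E = \int[P]_y (g * ((dotv u (Y y) / s2 - c) ^+ 2 * G z y) + 2 * G z y)%:E)%E.
    rewrite ge0_integral_EFinD//.
    - rewrite !ge0_integral_EFinZl//; first by rewrite GzE.
      - by move=> y; rewrite mulr_ge0 ?sqr_ge0.
      - exact: ltW.
    - exact: measurable_funM.
    - exact: measurable_funM.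
    - by move=> y; rewrite mulr_ge0 ?(ltW g0)// mulr_ge0 ?sqr_ge0.
    - by move=> y; rewrite mulr_ge0.
  have Rt : (\int[P]_y (expR (- h * c) * G (z + h *: u)%R y + expR (h * c) * G (z + (- h) *: u)%R y)%:E
     = (2 * M * expR (k * g))%:E)%E.
    rewrite ge0_integral_EFinD//.
    - rewrite !ge0_integral_EFinZl ?expR_ge0// !GE -!EFinM -EFinD; congr (_%:E).
      (* As [c] is the mean of [<u, .> / s2], the terms linear in [t] cancel, and [t = h] and
         [t = - h] give the same moment. *)
      have e (t : R) : t ^+ 2 = g -> expR (- t * c) * (M * expR
          (rho * (2 * dotv z (t *: u) + dotv (t *: u) (t *: u)) / (2 * s2))) = M * expR (k * g).
        move=> tg; rewrite mulrCA -expRD; congr (_ * expR _).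
        by rewrite !(dotvZl, dotvZr) /c /k -tg; field; rewrite gt_eqF.
      have e1 := e h hh; have e2 := e (- h); rewrite sqrrN opprK in e2.
      by rewrite e1 e2//; ring.
    - exact: measurable_funM.
    - exact: measurable_funM.
    - by move=> y; rewrite mulr_ge0// expR_ge0.
    - by move=> y; rewrite mulr_ge0// expR_ge0.
  rewrite L -Rt; apply: ge0_le_integral_EFin.
  - by apply: measurable_funD; exact: measurable_funM.
  - by apply: measurable_funD; exact: measurable_funM.
  - move=> y; rewrite addr_ge0 ?(mulr_ge0 _ (G0 _ _))//.
    by rewrite mulr_ge0 ?(ltW g0)// mulr_ge0 ?sqr_ge0.
  move=> y.
  have gl t : G (z + t *: u) y = expR (t * (dotv u (Y y) / s2)) * G z y.
    exact: (gibbs_weight_line d lam del lam_gt0 del_gt0).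
  rewrite !gl; move: (G z y) (G0 z y) => q q0.
  rewrite !mulrA -!expRD -[leRHS]mulrDl -hh.
  rewrite [leLHS](_ : _ =
    ((h * (dotv u (Y y) / s2 - c)) ^+ 2 + 2) * q); last by ring.
  apply: ler_wpM2r => //; apply: le_trans (sqr_le_expR _) _.
  rewrite le_eqVlt; apply/orP; left; apply/eqP.
  by congr (expR _ + expR _); rewrite /c; ring.
have A0 : (0 <= A)%E by apply: integral_ge0 => y _; rewrite lee_fin mulr_ge0 ?sqr_ge0.
have [A' AE] : exists A' : R, A = A'%:E.
  have := key 1 ltr01; rewrite mul1e.
  by case: (A) A0 => [A' _ _| |//]; [exists A'|].
have A'0 : 0 <= A' by rewrite -lee_fin -AE.
rewrite AE -EFinM lee_fin.
have k10 : 0 < (1 + k)^-1 by rewrite invr_gt0 ltr_wpDr.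
apply: (@le_linear_error _ _ _ (k * A') (1 + k)^-1) => //; first by rewrite mulr_ge0.
move=> g /andP[g0]; rewrite -[ltRHS]mul1r ltr_pdivlMr ?ltr_wpDr// mulrDr mulr1 => gk.
have := key g g0; rewrite AE -[X in (X + _)%E]EFinM -EFinD lee_fin => H.
have kg1 : k * g < 1 by lra.
have H' : expR (- (k * g)) * (2 * M + g * A') <= 2 * M.
  rewrite expRN mulrC ler_pdivrMr ?expR_gt0//; lra.
have M20 : 0 <= 2 * M by rewrite mulr_ge0// ltW.
have := le_of_expR_decay A' (2 * M) k g g M20 k0 kg1 (ltW g0) (ltW g0) H'.
rewrite (_ : (1 - k * g) * (g * A') = g * ((1 - k * g) * A')); last by ring.
rewrite (_ : k * g * (2 * M) = g * (2 * k * M)); last by ring.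
rewrite ler_pM2l// => {}H.
rewrite (_ : rho * dotv u u / s2 = 2 * k); last by rewrite /k; field; rewrite gt_eqF.
lra.
Qed.

End gaussian_second_moment.

(** * Thresholds on [lam] and conclusion of both cases *)

Lemma bounded_fun_le_sup {T : Type} {R : realType} (V : T -> R) (x : T) :
  bounded_fun V -> inf (range V) <= V x /\ V x <= sup (range V).
Proof.
move=> bV; split.
- apply: ge_inf; last by exists x.
  exact: bounded_fun_has_lbound.
- apply: ub_le_sup; last by exists x.
  exact: bounded_fun_has_ubound.
Qed.

(** With [B = del n + b], the threshold is the larger root in [lam] of
    [2 del m lam^2 - 2 B lam - r^2]; beyond it this polynomial is nonnegative, which gives [H2]. *)
Lemma dissipative_lam_bound {R : rcfType} (n lam del m b q r : R) :
  0 <= n -> 0 < lam -> 0 < del -> 0 < m -> 0 <= b -> q <= r ^+ 2 ->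
  (del * n + b + Num.sqrt ((del * n + b) ^+ 2 + 2 * del * m * r ^+ 2))
    / (2 * del * m) <= lam ->
  n + b / del + q / (2 * (lam * del)) <=
  (m / del + (2 * (lam * del))^-1) * (lam * del).
Proof.
move=> n0 lam0 del0 m0 b0 qr.
set B := del * n + b.
have dm0 : 0 < 2 * del * m by rewrite !mulr_gt0.
rewrite ler_pdivrMr// => H.
have D0 : 0 <= B ^+ 2 + 2 * del * m * r ^+ 2.
  by rewrite addr_ge0 ?sqr_ge0// mulr_ge0 ?sqr_ge0// ltW.
have s0 := sqrtr_ge0 (B ^+ 2 + 2 * del * m * r ^+ 2).
have ss := sqr_sqrtr D0.
have H2 : r ^+ 2 <= 2 * lam * (lam * (del * m) - B).
  move: (Num.sqrt _) s0 ss H => S S0 SS H.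
  have : S ^+ 2 <= (lam * (2 * del * m) - B) ^+ 2.
    by rewrite ler_sqr ?nnegrE//; lra.
  rewrite SS => H3.
  rewrite -(ler_pM2l dm0); lra.
have ld0 : 0 < 2 * (lam * del) by rewrite !mulr_gt0.
rewrite -(ler_pM2r ld0).
rewrite [leLHS](_ : _ = 2 * lam * B + q); last by rewrite /B; field; rewrite !gt_eqF.
rewrite [leRHS](_ : _ = 2 * lam * (lam * (del * m)) + lam * del); last by field; rewrite !gt_eqF.
have ld := mulr_gt0 lam0 del0.
lra.
Qed.

Theorem theorem4 (R : realType) (d : nat) (lam del : R) (f : 'rV[R]_d -> R) :
  (1 <= d)%N -> 0 < lam -> 0 < del ->
  (* (A1) *)
  continuous f -> (exists y0, forall y, f y0 <= f y) ->
  (* (A2) *)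
  (leb_int (fun y => (expR (- f y / del))%:E) < +oo)%E ->
  (* (i) *)
  (isC1 f -> forall m b : R, 0 < m -> 0 <= b ->
     (forall y, m * enorm y ^+ 2 - b <= dotv (grad f y) y) ->
     forall r : R, 0 < r ->
     (del * d%:R + b + Num.sqrt ((del * d%:R + b) ^+ 2 + 2 * del * m * r ^+ 2))
       / (2 * del * m) <= lam ->
     convex_on (@eball0 R d r) (soft_moreau f lam del))
  /\
  (* (ii) *)
  (forall (kappa : R) (V : 'rV[R]_d -> R), 0 < kappa -> bounded_fun V ->
     (forall y, f y = kappa / 2 * enorm y ^+ 2 + V y) ->
     (expR (osc V / del) - 1) / kappa <= lam ->
     convex_on setT (soft_moreau f lam del)).
Proof.
move=> _ lam0 del0 cf [y0 fy0] _.
have s20 : 0 < lam * del by exact: mulr_gt0.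
have [P HP] := exists_gauss_exp_measure d (lam * del) s20.
have seg := soft_moreau_convex_segment d lam del P lam0 del0 HP f (f y0) cf fy0.
have mgw z := measurable_gibbs_weight d lam del f cf z.
have gw0 z y : 0 <= gibbs_weight d lam del f z y by exact: expR_ge0.
have ZE z := integral_gibbs_weight d lam del P lam0 del0 HP f (f y0) cf fy0 z.
have Z0 z : 0 <= \int[P]_y gibbs_weight d lam del f z y.
  by apply: Rintegral_ge0 => y _.
split.
- move=> [df _] m b m0 b0 dis r r0 hlam x y t xr yr t01; apply: seg => // s s01.
  (* Centre 0: the variance is bounded by the raw second moment. *)
  exists 0; set z := s *: x + (1 - s) *: y; set u := x - y.
  have zr : dotv z z <= r ^+ 2.
    have norm_le (v : 'rV[R]_d) : eball0 r v -> dotv v v <= r ^+ 2.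
      by rewrite /eball0/= => vr; rewrite -enorm_sqr ler_sqr ?nnegrE ?sqrtr_ge0 ?(ltW r0)// ltW.
    have := norm_le x xr; have := norm_le y yr; have := dotv_le x y.
    rewrite /z !(dotvDl, dotvDr, dotvZl, dotvZr) (dotvC y x).
    have /andP[s0 s1] := s01.
    move: (dotv x x) (dotv y y) (dotv x y) => a c e h1 h2 h3.
    have : s * (1 - s) * (2 * e) <= s * (1 - s) * (a + c).
      by rewrite ler_wpM2l// mulr_ge0 ?subr_ge0 ?ltW.
    have : s * a <= s * r ^+ 2 by rewrite ler_pM2l.
    have : (1 - s) * c <= (1 - s) * r ^+ 2 by rewrite ler_pM2l// subr_gt0.
    lra.
  have hA := dissipative_second_moment d lam del P lam0 del0 HP f (f y0) cf fy0 m b z df m0 b0 dis.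
  have hp := dissipative_lam_bound d%:R lam del m b _ r (ler0n _ _) lam0 del0 m0 b0 zr hlam.
  have mYY : measurable_fun setT (fun w : d.-tuple (measurableTypeR R) =>
      dotv (row_of_seq d (tval w)) (row_of_seq d (tval w)) *
      gibbs_weight d lam del f z w).
    by apply: measurable_funM => //; exact: measurable_row_dotvv.
  set A := (\int[P]_w (dotv (row_of_seq d (tval w)) (row_of_seq d (tval w)) *
      gibbs_weight d lam del f z w)%:E)%E in hA.
  have a0 : 0 < m / del + (2 * (lam * del))^-1.
    by rewrite addr_gt0 ?divr_gt0// invr_gt0 mulr_gt0.
  have hA2 : (A <= (lam * del * \int[P]_w gibbs_weight d lam del f z w)%:E)%E.
    rewrite -(@lee_pmul2l _ (m / del + (2 * (lam * del))^-1)%:E) ?lte_fin//.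
    by apply: le_trans hA _; rewrite -EFinM lee_fin [leRHS]mulrA ler_wpM2r.
  apply: (@le_trans _ _ ((dotv u u / (lam * del) ^+ 2)%:E * A)%E); last first.
    apply: (@le_trans _ _ ((dotv u u / (lam * del) ^+ 2)%:E *
      (lam * del * \int[P]_w gibbs_weight d lam del f z w)%:E)%E).
      by apply: lee_wpmul2l => //; rewrite lee_fin divr_ge0 ?dotv_ge0 ?sqr_ge0.
    rewrite -EFinM lee_fin le_eqVlt; apply/orP; left; apply/eqP.
    by field; rewrite !gt_eqF.
  rewrite -ge0_integral_EFinZl//.
  + apply: ge0_le_integral_EFin.
    * apply: measurable_funM => //; apply: measurable_funX; apply: measurable_funB => //.
      by apply: measurable_funM => //; exact: measurable_row_dotv.
    * exact: measurable_funM.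
    * by move=> w; rewrite mulr_ge0 ?sqr_ge0.
    * move=> w; rewrite subr0 [leRHS]mulrA ler_wpM2r// expr_div_n [leRHS]mulrAC.
      rewrite ler_wpM2r ?invr_ge0 ?sqr_ge0//.
      exact: dotv_cauchy_schwarz.
  + by move=> w; rewrite mulr_ge0 ?dotv_ge0.
  + by rewrite divr_ge0 ?dotv_ge0 ?sqr_ge0.
- move=> kappa V kappa0 bV fE hlam x y t _ _ t01; apply: seg => // s s01.
  set z := s *: x + (1 - s) *: y; set u := x - y.
  pose G := gibbs_weight d lam del (fun y : 'rV[R]_d => kappa / 2 * dotv y y).
  set rho := (1 + kappa * lam)^-1.
  (* The mean of [<u, .> / (lam del)] under the Gaussian obtained by dropping [V]. *)
  exists (rho * dotv z u / (lam * del)).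
  have gwE w : gibbs_weight d lam del f z w = expR (- V (row_of_seq d (tval w)) / del) * G z w.
    rewrite /G /gibbs_weight -expRD fE enorm_sqr; congr expR; ring.
  have gw_le w : gibbs_weight d lam del f z w <= expR (- inf (range V) / del) * G z w.
    rewrite gwE ler_wpM2r ?expR_ge0// ler_expR ler_pM2r ?invr_gt0// lerN2.
    by have [] := bounded_fun_le_sup V (row_of_seq d (tval w)) bV.
  have gw_ge w : G z w <= expR (sup (range V) / del) * gibbs_weight d lam del f z w.
    rewrite gwE mulrA -expRD -[leLHS]mul1r ler_wpM2r ?expR_ge0// -expR0 ler_expR.
    rewrite -mulrDl divr_ge0 ?(ltW del0)// subr_ge0.
    by have [] := bounded_fun_le_sup V (row_of_seq d (tval w)) bV.
  have cq : continuous (fun y : 'rV[R]_d => kappa / 2 * dotv y y).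
    by move=> v; exact: (cvgM (cvg_cst _) (continuous_dotvv d v)).
  have mG : measurable_fun setT (G z) by exact: measurable_gibbs_weight.
  have G0 w : 0 <= G z w by exact: expR_ge0.
  have mw : measurable_fun setT (fun w : d.-tuple (measurableTypeR R) =>
      (dotv u (row_of_seq d (tval w)) / (lam * del) - rho * dotv z u / (lam * del)) ^+ 2).
    apply: measurable_funX; apply: measurable_funB => //.
    by apply: measurable_funM => //; exact: measurable_row_dotv.
  have hG := quadratic_second_moment d lam del P lam0 del0 HP kappa kappa0 z u.
  set Z := \int[P]_w _.
  (* The upper bound on [V] controls the Gaussian normalisation by [Z]; the lower bound is kept for
     the deviation integral. *)
  have hM : (\int[P]_w (G z w)%:E <= (expR (sup (range V) / del) * Z)%:E)%E.
    apply: (@le_trans _ _ (\int[P]_w (expR (sup (range V) / del) *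
        gibbs_weight d lam del f z w)%:E)%E).
      by apply: ge0_le_integral_EFin => //; exact: measurable_funM.
    by rewrite ge0_integral_EFinZl ?expR_ge0// ZE -EFinM.
  have rho0 : 0 < rho by rewrite invr_gt0 addr_gt0// mulr_gt0.
  have k0 : 0 <= rho * dotv u u / (lam * del).
    by rewrite divr_ge0 ?mulr_ge0 ?dotv_ge0// ltW.
  apply: (@le_trans _ _ ((expR (- inf (range V) / del))%:E *
      ((rho * dotv u u / (lam * del))%:E * (expR (sup (range V) / del) * Z)%:E))%E); last first.
    rewrite -!EFinM lee_fin.
    rewrite [leLHS](_ : _ =
      expR (- inf (range V) / del) * expR (sup (range V) / del) * rho *
      (dotv u u / (lam * del) * Z)); last by ring.
    rewrite -[leRHS]mul1r ler_wpM2r//.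
      by apply: mulr_ge0; [rewrite divr_ge0 ?dotv_ge0// ltW|exact: Z0].
    (* The two comparison factors multiply to [exp (osc V / del)], and the condition on [lam] says
       that this is at most [1 + kappa * lam], the inverse of [rho]. *)
    rewrite -expRD -mulrDl addrC -/(osc V) /rho ler_pdivrMr ?addr_gt0 ?mulr_gt0// mul1r.
    by move: hlam; rewrite ler_pdivrMr//; lra.
  apply: (@le_trans _ _ ((expR (- inf (range V) / del))%:E *
      \int[P]_w ((dotv u (row_of_seq d (tval w)) / (lam * del) -
        rho * dotv z u / (lam * del)) ^+ 2 * G z w)%:E)%E).
    rewrite -ge0_integral_EFinZl ?expR_ge0//.
    + apply: ge0_le_integral_EFin.
      * exact: measurable_funM.
      * by apply: measurable_funM => //; exact: measurable_funM.
      * by move=> w; rewrite mulr_ge0 ?sqr_ge0.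
      * by move=> w; rewrite mulrCA ler_wpM2l ?sqr_ge0.
    + exact: measurable_funM.
    + by move=> w; rewrite mulr_ge0 ?sqr_ge0.
  apply: lee_wpmul2l; first by rewrite lee_fin expR_ge0.
  apply: le_trans hG _; apply: lee_wpmul2l => //.
Qed.
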